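(* Let $\widetilde a:\mathbb H^2\to\mathbb C$ have an absolutely convergent Dirichlet series, $\widetilde a(s_1,s_2)=\sum_{(m,n)\in\mathbb N^2}a(m,n)m^{-s_1}n^{-s_2}$ for all $(s_1,s_2)\in\mathbb H^2$, with $\sum_{(m,n)\in\mathbb N^2}|a(m,n)|<\infty$. Then the following are equivalent: (i) $1/\widetilde a$ has an absolutely convergent Dirichlet series; (ii) the coefficient function $a=(a(m,n))$ is invertible in the Banach algebra $\ell^1(\mathbb N^2)$; (iii) $\widetilde a$ is bounded away from zero on $\mathbb H^2$.
   Context: $\mathbb N=\{1,2,\dots\}$, $\mathbb H=\{z\in\mathbb C:\operatorname{Re}z\ge 0\}$ is the closed right half plane. $\mathbb N^2$ is a semigroup under coordinatewise multiplication $(m_1,n_1)(m_2,n_2)=(m_1m_2,n_1n_2)$. A function $\widetilde a:\mathbb H^2\to\mathbb C$ has an absolutely convergent Dirichlet series if there is $a:\mathbb N^2\to\mathbb C$ with $\sum_{(m,n)}|a(m,n)|<\infty$ and $\widetilde a(s_1,s_2)=\sum_{(m,n)\in\mathbb N^2}a(m,n)m^{-s_1}n^{-s_2}$ for all $(s_1,s_2)\in\mathbb H^2$. $\ell^1(\mathbb N^2)=\{a:\mathbb N^2\to\mathbb C:\sum|a(m,n)|<\infty\}$ is a unital commutative Banach algebra with norm $\sum|a(m,n)|$ and convolution $(a\star b)(m,n)=\sum_{u_1u_2=m,\ v_1v_2=n}a(u_1,v_1)b(u_2,v_2)$. $\widetilde a$ is bounded away from zero if there is $k>0$ with $|\widetilde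 a(s_1,s_2)|\ge k$ for all $(s_1,s_2)\in\mathbb H^2$. *)

(* Defs.v *)
From Stdlib Require Import Reals Arith.
From Coquelicot Require Import Coquelicot.
Open Scope R_scope.

Definition inH (s : C) : Prop := 0 <= Re s.

(* n^{-s} = exp(-s log n) for a positive integer n, written out:
   e^{-(x + i y) ln n} = e^{-x ln n} (cos (y ln n) - i sin (y ln n)). *)
Definition npow_neg (n : nat) (s : C) : C :=
  (exp (- Re s * ln (INR n)) * cos (Im s * ln (INR n)),
   - (exp (- Re s * ln (INR n)) * sin (Im s * ln (INR n))))%R.

(* Double sequences indexed by N^2 are functions nat -> nat -> _ ;
   only the values at m, n >= 1 are ever used (value at index 0 is ignored). *)

Definition box_sum {G : AbelianMonoid} (f : nat -> nat -> G) (N : nat) : G :=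
  sum_n_m (fun m => sum_n_m (fun n => f m n) 1 N) 1 N.

(* a is in l^1(N^2): sum |a(m,n)| < infinity (the box sums of the
   nonnegative family |a| are bounded; boxes are cofinal in finite sets). *)
Definition l1 (a : nat -> nat -> C) : Prop :=
  exists M : R, forall N : nat, box_sum (fun m n => Cmod (a m n)) N <= M.

(* The value of the (absolutely convergent) Dirichlet series of a at (s1,s2):
   the sum over N^2 of a(m,n) m^{-s1} n^{-s2}, computed as limit of box sums
   (which equals the unordered sum for an absolutely summable family). *)
Definition dirichlet_sum_is (a : nat -> nat -> C) (s1 s2 : C) (v : C) : Prop :=
  filterlim (box_sum (fun m n => (a m n * npow_neg m s1 * npow_neg n s2)%C))
            eventually (locally v).

Definition represents (a : nat -> nat -> C) (F : C -> C -> C) : Prop :=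
  forall s1 s2 : C, inH s1 -> inH s2 -> dirichlet_sum_is a s1 s2 (F s1 s2).

Definition has_ACDS (F : C -> C -> C) : Prop :=
  exists a : nat -> nat -> C, l1 a /\ represents a F.

Definition dvdb (d m : nat) : bool := Nat.eqb (m mod d) 0.

Definition conv (a b : nat -> nat -> C) (m n : nat) : C :=
  sum_n_m (fun u1 =>
    sum_n_m (fun v1 =>
      if andb (dvdb u1 m) (dvdb v1 n) then (a u1 v1 * b (m / u1)%nat (n / v1)%nat)%C
      else (0:C)) 1 n) 1 m.

Definition delta11 (m n : nat) : C :=
  if andb (Nat.eqb m 1) (Nat.eqb n 1) then (1:C) else (0:C).

Definition l1_invertible (a : nat -> nat -> C) : Prop :=
  exists b : nat -> nat -> C, l1 b /\
    forall m n : nat, (1 <= m)%nat -> (1 <= n)%nat ->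
      conv a b m n = delta11 m n /\ conv b a m n = delta11 m n.

Definition bounded_away_from_zero (F : C -> C -> C) : Prop :=
  exists k : R, 0 < k /\
    forall s1 s2 : C, inH s1 -> inH s2 -> k <= Cmod (F s1 s2).

(* Main.v *)
Require Import Defs.
From Stdlib Require Import Reals Arith List Permutation Lia Lra Classical FunctionalExtensionality.
From Coquelicot Require Import Coquelicot.
Open Scope R_scope.

(** Any [x] in [l^1(N^2)] has coefficients bounded by [sup |x~|] over [H^2]: for a finite sum,
    averaging [f(s)] with a suitably rotated imaginary translate [f(s + ih)] removes one unwanted
    frequency at a time, and truncation gives the general case.  Hence evaluation is injective, and
    identities in [l^1(N^2)] can be checked on [H^2].

    A finite [Q] supported in [{1..N}^2] has [Q^j] supported on at most [(j+1)^(2N)] points, so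
    [||Q^j|| <= (j+1)^(2N) sup |Q~|^j].  Approximating by finite sums, the spectral radius of any
    element is at most the supremum of its transform.  Therefore, if [x] is invertible with
    [|x~| >= k] and [||x - y|| < k], the Neumann series for [1 - (x - y)/x] converges and [y] is
    invertible.

    If [|a~| >= k], a truncation of [a] still has a transform bounded away from zero, and so do
    its dilates [a(m,n) (mn)^(-t)], [t >= 0], whose transforms are translates of the original one.
    For large [t] they are close to the invertible constant [a(1,1)], and finitely many small steps
    in [t] bring the invertibility back to [t = 0]. *)

(* [ring] only recognises an equation whose type is syntactically [R] or [C]. *)
Ltac Rring := match goal with |- @eq _ ?x ?y => change (@eq R x y) end; ring.
Ltac Cring := match goal with |- @eq _ ?x ?y => change (@eq C x y) end; ring.

(** * Sums over lists *)

Fixpoint lsum {G : AbelianMonoid} {T : Type} (l : list T) (f : T -> G) : G :=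
  match l with
  | nil => zero
  | k :: l' => plus (f k) (lsum l' f)
  end.

Section ListSums.
Context {G : AbelianMonoid} {T : Type}.
Implicit Types (l : list T) (f g : T -> G).

Lemma lsum_ext l f g : (forall k, In k l -> f k = g k) -> lsum l f = lsum l g.
Proof.
  induction l as [|k l IH]; simpl; intros H; [easy|].
  rewrite H, IH; auto.
Qed.

Lemma lsum_zero l f : (forall k, In k l -> f k = zero) -> lsum l f = zero.
Proof.
  induction l as [|k l IH]; simpl; intros H; [easy|].
  rewrite H, IH, plus_zero_l; auto.
Qed.

Lemma lsum_app l l' f : lsum (l ++ l') f = plus (lsum l f) (lsum l' f).
Proof.
  induction l as [|k l IH]; simpl.
  - now rewrite plus_zero_l.
  - now rewrite IH, plus_assoc.
Qed.

Lemma lsum_perm l l' f : Permutation l l' -> lsum l f = lsum l' f.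
Proof.
  induction 1 as [|k l l' _ IH|u v l|l l' l'' _ IH1 _ IH2]; simpl.
  - easy.
  - now rewrite IH.
  - now rewrite !plus_assoc, (plus_comm (f u)).
  - now rewrite IH1.
Qed.

Lemma lsum_plus l f g :
  lsum l (fun k => plus (f k) (g k)) = plus (lsum l f) (lsum l g).
Proof.
  induction l as [|k l IH]; simpl.
  - now rewrite plus_zero_l.
  - rewrite IH, <- !plus_assoc; f_equal.
    now rewrite !plus_assoc, (plus_comm (g k)).
Qed.

Lemma lsum_map {U : Type} (h : U -> T) (l : list U) f :
  lsum (map h l) f = lsum l (fun u => f (h u)).
Proof. induction l as [|u l IH]; simpl; [easy|now rewrite IH]. Qed.

Lemma lsum_filter (p : T -> bool) l f :
  (forall k, In k l -> p k = false -> f k = zero) ->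
  lsum (filter p l) f = lsum l f.
Proof.
  induction l as [|k l IH]; simpl; intros H; [easy|].
  destruct (p k) eqn:E; simpl; rewrite IH; auto.
  rewrite (H k), plus_zero_l; auto.
Qed.

Hypothesis eq_dec : forall u v : T, {u = v} + {u <> v}.

(** Keeping only the members of [l] inside [l'] gives a duplicate-free list with the same elements
    as [l], hence a permutation of it; the discarded terms are zero. This is how index sets are
    enlarged throughout. *)
Lemma lsum_support l l' f : NoDup l -> NoDup l' -> incl l l' ->
  (forall k, In k l' -> ~ In k l -> f k = zero) -> lsum l f = lsum l' f.
Proof.
  intros Hl Hl' Hi H0.
  set (p := fun k => if in_dec eq_dec k l then true else false).
  rewrite <- (lsum_filter p l').
  - apply lsum_perm, NoDup_Permutation; [easy|now apply NoDup_filter|].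
    intros k; rewrite filter_In; unfold p.
    destruct (in_dec eq_dec k l); intuition (auto; discriminate).
  - intros k Hk; unfold p; destruct (in_dec eq_dec k l); [discriminate|auto].
Qed.

Lemma lsum_single l f k0 : NoDup l -> In k0 l ->
  (forall k, In k l -> k <> k0 -> f k = zero) -> lsum l f = f k0.
Proof.
  intros Hl Hk H0.
  rewrite <- (lsum_support (k0 :: nil) l); simpl.
  - apply plus_zero_r.
  - constructor; [easy|constructor].
  - easy.
  - intros k [<-|[]]; easy.
  - intros k Hin Hn; apply H0; intuition.
Qed.

End ListSums.

Lemma lsum_swap {G : AbelianMonoid} {T U : Type} (l : list T) (l' : list U)
    (f : T -> U -> G) :
  lsum l (fun u => lsum l' (fun v => f u v)) =
  lsum l' (fun v => lsum l (fun u => f u v)).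
Proof.
  induction l as [|u l IH]; simpl.
  - symmetry; now apply lsum_zero.
  - now rewrite IH, lsum_plus.
Qed.

Lemma lsum_list_prod {G : AbelianMonoid} {T U : Type} (l : list T) (l' : list U)
    (f : T * U -> G) :
  lsum (list_prod l l') f = lsum l (fun u => lsum l' (fun v => f (u, v))).
Proof.
  induction l as [|u l IH]; simpl; [easy|].
  now rewrite lsum_app, lsum_map, IH.
Qed.

Lemma sum_n_m_lsum {G : AbelianMonoid} (f : nat -> G) (N : nat) :
  sum_n_m f 1 N = lsum (seq 1 N) f.
Proof.
  induction N as [|N IH].
  - now rewrite sum_n_m_zero by lia.
  - rewrite sum_n_Sm by lia.
    rewrite seq_S, lsum_app, IH; simpl.
    now rewrite plus_zero_r.
Qed.

Lemma Rsum_plus {T} (l : list T) (f g : T -> R) :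
  lsum l (fun k => f k + g k) = lsum l f + lsum l g.
Proof. exact (lsum_plus l f g). Qed.

Lemma Rsum_zero {T} (l : list T) (f : T -> R) :
  (forall k, In k l -> f k = 0) -> lsum l f = 0.
Proof. exact (lsum_zero (G := R_AbelianMonoid) l f). Qed.

Lemma Rsum_scal {T} (l : list T) (c : R) (f : T -> R) :
  lsum l (fun k => c * f k) = c * lsum l f.
Proof.
  induction l as [|k l IH]; simpl.
  - change (0 = c * 0); Rring.
  - rewrite IH; change (c * f k + c * lsum l f = c * (f k + lsum l f)); Rring.
Qed.

Lemma Rsum_le {T} (l : list T) (f g : T -> R) :
  (forall k, In k l -> f k <= g k) -> lsum l f <= lsum l g.
Proof.
  induction l as [|k l IH]; simpl; intros H; [apply Rle_refl|].
  apply Rplus_le_compat; auto.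
Qed.

Lemma Rsum_nonneg {T} (l : list T) (f : T -> R) :
  (forall k, In k l -> 0 <= f k) -> 0 <= lsum l f.
Proof.
  intros H; apply Rle_trans with (lsum l (fun _ => 0)); [|now apply Rsum_le].
  apply Req_le; symmetry; now apply Rsum_zero.
Qed.

Lemma Rsum_const {T} (l : list T) (c : R) :
  lsum l (fun _ => c) = INR (length l) * c.
Proof.
  induction l as [|k l IH]; [change (0 = 0 * c); Rring|].
  change (lsum (k :: l) (fun _ => c)) with (c + lsum l (fun _ => c)).
  rewrite IH; change (length (k :: l)) with (S (length l)).
  rewrite S_INR; Rring.
Qed.

Lemma Csum_plus {T} (l : list T) (f g : T -> C) :
  (lsum l (fun k => f k + g k) = lsum l f + lsum l g)%C.
Proof. exact (lsum_plus l f g). Qed.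

Lemma Csum_zero {T} (l : list T) (f : T -> C) :
  (forall k, In k l -> f k = RtoC 0) -> lsum l f = RtoC 0.
Proof. exact (lsum_zero (G := C_AbelianMonoid) l f). Qed.

Lemma Csum_scal {T} (l : list T) (c : C) (f : T -> C) :
  (lsum l (fun k => c * f k) = c * lsum l f)%C.
Proof.
  induction l as [|k l IH]; simpl.
  - change (RtoC 0 = c * 0)%C; Cring.
  - rewrite IH; change plus with Cplus; Cring.
Qed.

Lemma Csum_minus {T} (l : list T) (f g : T -> C) :
  (lsum l (fun k => f k - g k) = lsum l f - lsum l g)%C.
Proof.
  induction l as [|k l IH]; simpl.
  - change (RtoC 0 = 0 - 0)%C; Cring.
  - rewrite IH; change plus with Cplus; Cring.
Qed.

Lemma Cmod_lsum {T} (l : list T) (f : T -> C) :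
  Cmod (lsum l f) <= lsum l (fun k => Cmod (f k)).
Proof.
  induction l as [|k l IH]; simpl.
  - change (Cmod 0 <= 0); rewrite Cmod_0; lra.
  - eapply Rle_trans; [apply Cmod_triangle|].
    now apply Rplus_le_compat_l.
Qed.

(** * The monoid of index pairs *)

Definition kmul (u v : nat * nat) : nat * nat := (fst u * fst v, snd u * snd v)%nat.
Definition kpos (k : nat * nat) : Prop := (1 <= fst k /\ 1 <= snd k)%nat.
Definition kmax (k : nat * nat) : nat := max (fst k) (snd k).

Lemma key_eq_dec (u v : nat * nat) : {u = v} + {u <> v}.
Proof. decide equality; apply Nat.eq_dec. Qed.

Definition Box (N : nat) : list (nat * nat) := list_prod (seq 1 N) (seq 1 N).

Lemma in_Box k N : In k (Box N) <-> kpos k /\ (kmax k <= N)%nat.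
Proof.
  destruct k as [m n]; unfold Box, kpos, kmax.
  rewrite in_prod_iff, !in_seq; simpl; lia.
Qed.

Lemma NoDup_prod {T U} (l : list T) (l' : list U) :
  NoDup l -> NoDup l' -> NoDup (list_prod l l').
Proof.
  intros Hl Hl'; induction Hl as [|u l Hu Hl IH]; simpl; [constructor|].
  apply NoDup_app.
  - apply FinFun.Injective_map_NoDup; [|easy].
    intros v w E; now inversion E.
  - easy.
  - intros [x y]; rewrite in_map_iff, in_prod_iff.
    intros [v [E _]] [Hx _]; inversion E; subst; easy.
Qed.

Lemma NoDup_Box N : NoDup (Box N).
Proof. apply NoDup_prod; apply seq_NoDup. Qed.

Lemma Box_incl M N : (M <= N)%nat -> incl (Box M) (Box N).
Proof. intros H k; rewrite !in_Box; intuition lia. Qed.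

Lemma kmul_comm u v : kmul u v = kmul v u.
Proof. unfold kmul; f_equal; apply Nat.mul_comm. Qed.

Lemma kmul_pos u v : kpos u -> kpos v -> kpos (kmul u v).
Proof. unfold kpos, kmul; simpl; nia. Qed.

Lemma kmax_kmul_l u v : kpos v -> (kmax u <= kmax (kmul u v))%nat.
Proof. unfold kpos, kmax, kmul; simpl; nia. Qed.

Lemma kmax_kmul_r u v : kpos u -> (kmax v <= kmax (kmul u v))%nat.
Proof. rewrite kmul_comm; apply kmax_kmul_l. Qed.

Lemma kmul_in_Box u v M N : In u (Box M) -> In v (Box M) -> (M * M <= N)%nat ->
  In (kmul u v) (Box N).
Proof.
  rewrite !in_Box; intros [Hu Hu'] [Hv Hv'] HN.
  split; [now apply kmul_pos|].
  unfold kmax, kmul, kpos in *; simpl; nia.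
Qed.

Lemma box_sum_lsum {G : AbelianMonoid} (f : nat -> nat -> G) N :
  box_sum f N = lsum (Box N) (fun k => f (fst k) (snd k)).
Proof.
  unfold box_sum, Box; rewrite lsum_list_prod, sum_n_m_lsum.
  apply lsum_ext; intros m _; now rewrite sum_n_m_lsum.
Qed.

Lemma lsum_Box_mono (f : nat * nat -> R) M N : (M <= N)%nat ->
  (forall k, kpos k -> 0 <= f k) -> lsum (Box M) f <= lsum (Box N) f.
Proof.
  intros H Hf.
  (* Extending [f] by zero off the small box puts both sums over [Box N], where they compare term by
     term. *)
  set (g := fun k => if in_dec key_eq_dec k (Box M) then f k else 0).
  rewrite (lsum_ext (Box M) f g).
  2:{ intros k Hk; unfold g; now destruct (in_dec key_eq_dec k (Box M)). }
  rewrite (lsum_support key_eq_dec (Box M) (Box N)).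
  - apply Rsum_le; intros k Hk; unfold g.
    destruct (in_dec key_eq_dec k (Box M)); [lra|].
    apply Hf; now apply in_Box in Hk.
  - apply NoDup_Box.
  - apply NoDup_Box.
  - now apply Box_incl.
  - intros k _ Hk; unfold g; now destruct (in_dec key_eq_dec k (Box M)).
Qed.

(** * Convolution and the norm *)

Definition uncurry2 (a : nat -> nat -> C) (k : nat * nat) : C := a (fst k) (snd k).

(** Summing over pairs [u], [v] with product [k] avoids division and treats both factors alike.
    Factors of [k] have coordinates at most [kmax k], so this finite box sees all of them. *)
Definition kconv (x y : nat * nat -> C) (k : nat * nat) : C :=
  lsum (Box (kmax k)) (fun u => lsum (Box (kmax k)) (fun v =>
    if key_eq_dec (kmul u v) k then (x u * y v)%C else (0 : C))).

(** Pairs outside [Box (kmax k)] cannot multiply to [k]. With one common box for all [k], the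
    summations over [k], [u] and [v] can be interchanged. *)
Lemma kconv_Box x y k N : (kmax k <= N)%nat ->
  kconv x y k = lsum (Box N) (fun u => lsum (Box N) (fun v =>
    if key_eq_dec (kmul u v) k then (x u * y v)%C else (0 : C))).
Proof.
  intros HN; unfold kconv.
  transitivity (lsum (Box (kmax k)) (fun u => lsum (Box N) (fun v =>
    if key_eq_dec (kmul u v) k then (x u * y v)%C else (0 : C)))).
  - apply lsum_ext; intros u Hu.
    apply (lsum_support key_eq_dec); try apply NoDup_Box; [now apply Box_incl|].
    intros v Hv Hn; destruct (key_eq_dec (kmul u v) k) as [E|E]; [|easy].
    exfalso; apply Hn, in_Box; apply in_Box in Hu; apply in_Box in Hv.
    split; [easy|]; rewrite <- E; now apply kmax_kmul_r.
  - apply (lsum_support key_eq_dec); try apply NoDup_Box; [now apply Box_incl|].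
    intros u Hu Hn; apply Csum_zero; intros v Hv.
    destruct (key_eq_dec (kmul u v) k) as [E|E]; [|easy].
    exfalso; apply Hn, in_Box; apply in_Box in Hu; apply in_Box in Hv.
    split; [easy|]; rewrite <- E; now apply kmax_kmul_l.
Qed.

Lemma conv_kconv a b m n : (1 <= m)%nat -> (1 <= n)%nat ->
  conv a b m n = kconv (uncurry2 a) (uncurry2 b) (m, n).
Proof.
  intros Hm Hn; unfold conv, kconv.
  set (M := kmax (m, n)).
  set (g := fun u : nat * nat => lsum (Box M) (fun v =>
    if key_eq_dec (kmul u v) (m, n) then (uncurry2 a u * uncurry2 b v)%C else (0 : C))).
  transitivity (lsum (list_prod (seq 1 m) (seq 1 n)) g).
  - rewrite lsum_list_prod, sum_n_m_lsum.
    apply lsum_ext; intros u1 Hu1; rewrite sum_n_m_lsum.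
    apply lsum_ext; intros v1 Hv1; unfold g.
    apply in_seq in Hu1; apply in_seq in Hv1.
    unfold dvdb.
    destruct (Nat.eqb_spec (m mod u1) 0) as [E1|E1];
      destruct (Nat.eqb_spec (n mod v1) 0) as [E2|E2]; simpl.
    + apply Nat.Div0.mod_divides in E1; apply Nat.Div0.mod_divides in E2.
      destruct E1 as [u2 E1], E2 as [v2 E2].
      (* Once [u1] divides [m] and [v1] divides [n], the pair of quotients is the only cofactor. *)
      rewrite (lsum_single key_eq_dec (Box M) _ (u2, v2)).
      * destruct (key_eq_dec (kmul (u1, v1) (u2, v2)) (m, n)) as [E|E].
        -- unfold uncurry2; simpl; rewrite E1, E2.
           now rewrite (Nat.mul_comm u1), (Nat.mul_comm v1), !Nat.div_mul by lia.
        -- exfalso; apply E; unfold kmul; simpl; now subst.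
      * apply NoDup_Box.
      * apply in_Box; unfold kpos, kmax, M, kmax; simpl; nia.
      * intros [p q] _ Hpq.
        destruct (key_eq_dec (kmul (u1, v1) (p, q)) (m, n)) as [E|E]; [|easy].
        exfalso; apply Hpq; unfold kmul in E; simpl in E; inversion E.
        f_equal; nia.
    + symmetry; apply Csum_zero; intros [p q] _.
      destruct (key_eq_dec (kmul (u1, v1) (p, q)) (m, n)) as [E|E]; [|easy].
      exfalso; apply E2; unfold kmul in E; simpl in E; inversion E.
      rewrite Nat.mul_comm; apply Nat.Div0.mod_mul.
    + symmetry; apply Csum_zero; intros [p q] _.
      destruct (key_eq_dec (kmul (u1, v1) (p, q)) (m, n)) as [E|E]; [|easy].
      exfalso; apply E1; unfold kmul in E; simpl in E; inversion E.
      rewrite Nat.mul_comm; apply Nat.Div0.mod_mul.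
    + symmetry; apply Csum_zero; intros [p q] _.
      destruct (key_eq_dec (kmul (u1, v1) (p, q)) (m, n)) as [E|E]; [|easy].
      exfalso; apply E1; unfold kmul in E; simpl in E; inversion E.
      rewrite Nat.mul_comm; apply Nat.Div0.mod_mul.
  (* Passing from the rectangle of sides [m], [n] to the square box adds only zeros: a factor of [m]
     is at most [m], and a factor of [n] at most [n]. *)
  - apply (lsum_support key_eq_dec).
    + apply NoDup_prod; apply seq_NoDup.
    + apply NoDup_Box.
    + intros [u v]; rewrite in_prod_iff, !in_seq, in_Box.
      unfold kpos, M, kmax; simpl; lia.
    + intros [u v] Hk Hn'; apply in_Box in Hk; unfold kpos in Hk; simpl in Hk.
      rewrite in_prod_iff, !in_seq in Hn'.
      unfold g; apply Csum_zero; intros [p q] Hpq.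
      apply in_Box in Hpq; unfold kpos in Hpq; simpl in Hpq.
      destruct (key_eq_dec (kmul (u, v) (p, q)) (m, n)) as [E|E]; [|easy].
      exfalso; apply Hn'; unfold kmul in E; simpl in E; inversion E; nia.
Qed.

(** An upper bound stands in for the norm as a number, so that estimates compose without forming
    suprema. *)
Definition normle (x : nat * nat -> C) (A : R) : Prop :=
  forall N, lsum (Box N) (fun k => Cmod (x k)) <= A.

Definition summable (x : nat * nat -> C) : Prop := exists A, normle x A.

Lemma l1_summable a : l1 a <-> summable (uncurry2 a).
Proof.
  split; intros [M H]; exists M; intros N.
  - specialize (H N); rewrite box_sum_lsum in H; exact H.
  - rewrite box_sum_lsum; exact (H N).
Qed.

Lemma normle_nonneg x A : normle x A -> 0 <= A.
Proof.
  intros H; eapply Rle_trans; [|apply (H 0%nat)].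
  apply Rle_refl.
Qed.

Lemma normle_weaken x A B : normle x A -> A <= B -> normle x B.
Proof. intros H HAB N; eapply Rle_trans; [apply H|exact HAB]. Qed.

Lemma normle_le x y A : (forall k, kpos k -> Cmod (x k) <= Cmod (y k)) ->
  normle y A -> normle x A.
Proof.
  intros H Hy N; eapply Rle_trans; [|apply (Hy N)].
  apply Rsum_le; intros k Hk; apply H; now apply in_Box in Hk.
Qed.

Lemma normle_ext x y A : (forall k, kpos k -> x k = y k) -> normle y A -> normle x A.
Proof.
  intros H; apply normle_le; intros k Hk; rewrite H by easy; apply Rle_refl.
Qed.

Lemma normle_scal x y A q : 0 <= q -> (forall k, kpos k -> Cmod (y k) <= q * Cmod (x k)) ->
  normle x A -> normle y (q * A).
Proof.
  intros Hq Hy Hx N.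
  apply Rle_trans with (q * lsum (Box N) (fun k => Cmod (x k))).
  - rewrite <- Rsum_scal; apply Rsum_le; intros k Hk.
    apply Hy; now apply in_Box in Hk.
  - apply Rmult_le_compat_l; [easy|apply Hx].
Qed.

Lemma normle_plus x y A B : normle x A -> normle y B ->
  normle (fun k => x k + y k)%C (A + B).
Proof.
  intros Hx Hy N.
  apply Rle_trans with
    (lsum (Box N) (fun k => Cmod (x k)) + lsum (Box N) (fun k => Cmod (y k))).
  - rewrite <- Rsum_plus; apply Rsum_le; intros k _; apply Cmod_triangle.
  - apply Rplus_le_compat; auto.
Qed.

Lemma normle_opp x A : normle x A -> normle (fun k => - x k)%C A.
Proof. apply normle_le; intros k _; rewrite Cmod_opp; apply Rle_refl. Qed.

Lemma normle_minus x y A B : normle x A -> normle y B ->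
  normle (fun k => x k - y k)%C (A + B).
Proof. intros Hx Hy; apply normle_plus; [easy|now apply normle_opp]. Qed.

Lemma summable_plus x y : summable x -> summable y -> summable (fun k => x k + y k)%C.
Proof. intros [A HA] [B HB]; exists (A + B); now apply normle_plus. Qed.

Lemma summable_minus x y : summable x -> summable y -> summable (fun k => x k - y k)%C.
Proof. intros [A HA] [B HB]; exists (A + B); now apply normle_minus. Qed.

Lemma Cmod_le_normle x A k : kpos k -> normle x A -> Cmod (x k) <= A.
Proof.
  intros Hk Hx; eapply Rle_trans; [|apply (Hx (kmax k))].
  assert (Hin : In k (Box (kmax k))) by (apply in_Box; auto).
  clear Hk; induction (Box (kmax k)) as [|u l IH]; [easy|].
  change (Cmod (x k) <= Cmod (x u) + lsum l (fun v => Cmod (x v))).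
  destruct Hin as [->|Hin].
  - assert (0 <= lsum l (fun v => Cmod (x v))).
    { apply Rsum_nonneg; intros; apply Cmod_ge_0. }
    lra.
  - specialize (IH Hin); pose proof (Cmod_ge_0 (x u)); lra.
Qed.

Lemma lsum_indicator (l : list (nat * nat)) (c : R) k0 : NoDup l -> 0 <= c ->
  lsum l (fun k => if key_eq_dec k0 k then c else 0) <= c.
Proof.
  intros Hl Hc; destruct (in_dec key_eq_dec k0 l) as [Hi|Hi].
  - rewrite (lsum_single key_eq_dec l _ k0).
    + destruct (key_eq_dec k0 k0); lra.
    + easy.
    + easy.
    + intros k _ Hk; destruct (key_eq_dec k0 k); [now subst|easy].
  - apply Rle_trans with 0; [|easy]; apply Req_le.
    apply Rsum_zero; intros k Hk.
    destruct (key_eq_dec k0 k); [now subst|easy].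
Qed.

Lemma lsum_prod_R {T U} (l : list T) (l' : list U) (f : T -> R) (g : U -> R) :
  lsum l (fun u => lsum l' (fun v => f u * g v)) = lsum l f * lsum l' g.
Proof.
  transitivity (lsum l (fun u => lsum l' g * f u)).
  - apply lsum_ext; intros u _; rewrite Rsum_scal; Rring.
  - rewrite Rsum_scal; Rring.
Qed.

Lemma lsum_prod_C {T U} (l : list T) (l' : list U) (f : T -> C) (g : U -> C) :
  lsum l (fun u => lsum l' (fun v => f u * g v)%C) = (lsum l f * lsum l' g)%C.
Proof.
  transitivity (lsum l (fun u => lsum l' g * f u)%C).
  - apply lsum_ext; intros u _; rewrite Csum_scal; Cring.
  - rewrite Csum_scal; Cring.
Qed.

(** After summing over [k] first, each pair [u], [v] is counted at most once, namely at its product;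
    what remains is dominated by the product of two box sums. *)
Lemma normle_kconv x y A B : normle x A -> normle y B -> normle (kconv x y) (A * B).
Proof.
  intros Hx Hy N.
  apply Rle_trans with (lsum (Box N) (fun k => lsum (Box N) (fun u => lsum (Box N) (fun v =>
    if key_eq_dec (kmul u v) k then Cmod (x u) * Cmod (y v) else 0)))).
  - apply Rsum_le; intros k Hk; apply in_Box in Hk.
    rewrite (kconv_Box x y k N) by easy.
    eapply Rle_trans; [apply Cmod_lsum|]; apply Rsum_le; intros u _.
    eapply Rle_trans; [apply Cmod_lsum|]; apply Rsum_le; intros v _.
    destruct (key_eq_dec (kmul u v) k); [rewrite Cmod_mult|rewrite Cmod_0]; apply Rle_refl.
  - rewrite lsum_swap.
    apply Rle_trans with (lsum (Box N) (fun u => lsum (Box N) (fun v =>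
      Cmod (x u) * Cmod (y v)))).
    + apply Rsum_le; intros u _; rewrite lsum_swap; apply Rsum_le; intros v _.
      apply lsum_indicator; [apply NoDup_Box|].
      apply Rmult_le_pos; apply Cmod_ge_0.
    + rewrite lsum_prod_R.
      apply Rmult_le_compat; auto; apply Rsum_nonneg; intros; apply Cmod_ge_0.
Qed.

Lemma summable_kconv x y : summable x -> summable y -> summable (kconv x y).
Proof. intros [A HA] [B HB]; exists (A * B); now apply normle_kconv. Qed.

Definition kdelta (k : nat * nat) : C :=
  if key_eq_dec k (1, 1)%nat then (1 : C) else (0 : C).

Lemma normle_kdelta : normle kdelta 1.
Proof.
  intros N.
  apply Rle_trans with (lsum (Box N) (fun k => if key_eq_dec (1, 1)%nat k then 1 else 0)).
  - apply Rsum_le; intros k _; unfold kdelta.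
    destruct (key_eq_dec k (1, 1)%nat), (key_eq_dec (1, 1)%nat k); subst; try easy;
      rewrite ?Cmod_1, ?Cmod_0; lra.
  - apply lsum_indicator; [apply NoDup_Box|lra].
Qed.

Fixpoint kpow (x : nat * nat -> C) (n : nat) : nat * nat -> C :=
  match n with
  | O => kdelta
  | S n' => kconv x (kpow x n')
  end.

Lemma summable_kpow x n : summable x -> summable (kpow x n).
Proof.
  intros Hx; induction n as [|n IH]; simpl.
  - exists 1; exact normle_kdelta.
  - now apply summable_kconv.
Qed.

(** * Truncation to boxes *)

Definition trunc (N : nat) (x : nat * nat -> C) (k : nat * nat) : C :=
  if in_dec key_eq_dec k (Box N) then x k else (0 : C).

Lemma normle_trunc N x A : normle x A -> normle (trunc N x) A.
Proof.
  apply normle_le; intros k _; unfold trunc.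
  destruct (in_dec key_eq_dec k (Box N)); [apply Rle_refl|].
  rewrite Cmod_0; apply Cmod_ge_0.
Qed.

Lemma summable_trunc N x : summable x -> summable (trunc N x).
Proof. intros [A H]; exists A; now apply normle_trunc. Qed.

Lemma lsum_trunc_split N M x : (M <= N)%nat ->
  lsum (Box N) (fun k => Cmod (x k - trunc M x k)) =
  lsum (Box N) (fun k => Cmod (x k)) - lsum (Box M) (fun k => Cmod (x k)).
Proof.
  intros H.
  assert (E : lsum (Box M) (fun k => Cmod (x k)) =
              lsum (Box N) (fun k => Cmod (trunc M x k))).
  { rewrite (lsum_ext _ _ (fun k => Cmod (trunc M x k))).
    - apply (lsum_support key_eq_dec); try apply NoDup_Box; [now apply Box_incl|].
      intros k _ Hk; unfold trunc.
      destruct (in_dec key_eq_dec k (Box M)); [easy|apply Cmod_0].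
    - intros k Hk; unfold trunc; now destruct (in_dec key_eq_dec k (Box M)). }
  assert (F : lsum (Box N) (fun k => Cmod (x k - trunc M x k)) +
              lsum (Box N) (fun k => Cmod (trunc M x k)) =
              lsum (Box N) (fun k => Cmod (x k))).
  { rewrite <- Rsum_plus; apply lsum_ext; intros k _; unfold trunc.
    destruct (in_dec key_eq_dec k (Box M)).
    - replace (x k - x k)%C with (RtoC 0) by ring; rewrite Cmod_0; Rring.
    - replace (x k - 0)%C with (x k) by ring; rewrite Cmod_0; Rring. }
  rewrite E; lra.
Qed.

Lemma normle_tail_mono x M N A : (M <= N)%nat ->
  normle (fun k => x k - trunc M x k)%C A -> normle (fun k => x k - trunc N x k)%C A.
Proof.
  intros HM; apply normle_le; intros k Hk; unfold trunc.
  destruct (in_dec key_eq_dec k (Box N)) as [I|I].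
  - replace (x k - x k)%C with (RtoC 0) by ring; rewrite Cmod_0; apply Cmod_ge_0.
  - destruct (in_dec key_eq_dec k (Box M)) as [J|J]; [|apply Rle_refl].
    exfalso; apply I; revert J; now apply Box_incl.
Qed.

(** The box sums of moduli have a least upper bound [S]; a box whose sum exceeds [S - eps] leaves at
    most [eps] for everything outside it. *)
Lemma trunc_tail x eps : summable x -> 0 < eps ->
  exists M, forall N, (M <= N)%nat -> normle (fun k => x k - trunc N x k)%C eps.
Proof.
  intros [A HA] He.
  set (E := fun r => exists N, r = lsum (Box N) (fun k => Cmod (x k))).
  destruct (completeness E) as [S [Hub Hlub]].
  - exists A; intros r [N ->]; apply HA.
  - exists (lsum (Box 0) (fun k => Cmod (x k))); now exists 0%nat.
  - assert (HN : exists N, S - eps < lsum (Box N) (fun k => Cmod (x k))).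
    { apply NNPP; intros Hn.
      assert (S <= S - eps); [|lra].
      apply Hlub; intros r [N ->].
      apply Rnot_lt_le; intros Hlt; apply Hn; now exists N. }
    destruct HN as [M HM]; exists M; intros M' HM'.
    apply (normle_tail_mono x M M'); [easy|]; intros N.
    apply Rle_trans with
      (lsum (Box (max M N)) (fun k => Cmod (x k - trunc M x k))).
    + apply lsum_Box_mono; [lia|]; intros; apply Cmod_ge_0.
    + rewrite lsum_trunc_split by lia.
      assert (lsum (Box (max M N)) (fun k => Cmod (x k)) <= S) by (apply Hub; eexists; reflexivity).
      lra.
Qed.

(** * Evaluation of Dirichlet series *)

Lemma npow_neg_plus n s t : npow_neg n (s + t)%C = (npow_neg n s * npow_neg n t)%C.
Proof.
  destruct s as [s1 s2], t as [t1 t2].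
  unfold npow_neg, Cplus, Cmult, Re, Im; simpl.
  replace (- (s1 + t1) * ln (INR n)) with (- s1 * ln (INR n) + - t1 * ln (INR n)) by ring.
  rewrite exp_plus, (Rmult_plus_distr_r s2 t2), cos_plus, sin_plus.
  f_equal; ring.
Qed.

Lemma npow_neg_mult m n s : (1 <= m)%nat -> (1 <= n)%nat ->
  npow_neg (m * n) s = (npow_neg m s * npow_neg n s)%C.
Proof.
  intros Hm Hn; destruct s as [s1 s2].
  unfold npow_neg, Cmult, Re, Im; simpl.
  rewrite mult_INR, ln_mult by (apply lt_0_INR; lia).
  rewrite !Rmult_plus_distr_l, exp_plus, cos_plus, sin_plus.
  f_equal; ring.
Qed.

Lemma Cmod_npow_neg n s : Cmod (npow_neg n s) = exp (- Re s * ln (INR n)).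
Proof.
  unfold npow_neg, Cmod; simpl.
  set (e := exp _); set (t := Im s * ln (INR n)).
  replace (e * cos t * (e * cos t * 1) + - (e * sin t) * (- (e * sin t) * 1))
    with (e * e * ((Rsqr (sin t)) + Rsqr (cos t))) by (unfold Rsqr; ring).
  rewrite sin2_cos2, Rmult_1_r.
  apply sqrt_square, Rlt_le, exp_pos.
Qed.

Lemma ln_INR_nonneg n : (1 <= n)%nat -> 0 <= ln (INR n).
Proof.
  intros H; rewrite <- ln_1; apply ln_le; [lra|].
  change 1 with (INR 1); now apply le_INR.
Qed.

Lemma exp_neg_le_1 t : t <= 0 -> exp t <= 1.
Proof.
  intros H; rewrite <- exp_0; destruct H as [H| ->]; [|apply Rle_refl].
  now apply Rlt_le, exp_increasing.
Qed.

Lemma Cmod_npow_neg_le n s : (1 <= n)%nat -> inH s -> Cmod (npow_neg n s) <= 1.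
Proof.
  unfold inH; intros Hn Hs; rewrite Cmod_npow_neg; apply exp_neg_le_1.
  pose proof (ln_INR_nonneg n Hn); nra.
Qed.

Lemma npow_neg_1 s : npow_neg 1 s = RtoC 1.
Proof.
  unfold npow_neg; simpl; rewrite ln_1, !Rmult_0_r, exp_0, cos_0, sin_0.
  unfold RtoC; f_equal; ring.
Qed.

(** For fixed [s] in [H2] this is a bounded character of the multiplicative semigroup of pairs, and
    for fixed [k] it turns addition of points into multiplication. *)
Definition chi (s : C * C) (k : nat * nat) : C :=
  (npow_neg (fst k) (fst s) * npow_neg (snd k) (snd s))%C.

Definition H2 (s : C * C) : Prop := inH (fst s) /\ inH (snd s).

Definition splus (s t : C * C) : C * C := (fst s + fst t, snd s + snd t)%C.

Lemma chi_splus s t k : chi (splus s t) k = (chi s k * chi t k)%C.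
Proof. unfold chi, splus; simpl; rewrite !npow_neg_plus; ring. Qed.

Lemma chi_kmul s u v : kpos u -> kpos v -> chi s (kmul u v) = (chi s u * chi s v)%C.
Proof.
  intros [] []; unfold chi, kmul; simpl; rewrite !npow_neg_mult by easy; ring.
Qed.

Lemma Cmod_chi_le s k : H2 s -> kpos k -> Cmod (chi s k) <= 1.
Proof.
  intros [H1 H2] [P1 P2]; unfold chi; rewrite Cmod_mult.
  rewrite <- (Rmult_1_l 1).
  apply Rmult_le_compat; try apply Cmod_ge_0; now apply Cmod_npow_neg_le.
Qed.

Lemma chi_one s : chi s (1, 1)%nat = RtoC 1.
Proof. unfold chi; simpl; rewrite !npow_neg_1; ring. Qed.

(** * Convergence of complex sequences *)

Definition Cvg (u : nat -> C) (v : C) : Prop := is_lim_seq (fun n => Cmod (u n - v)) 0.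

Lemma Cvg_squeeze u v e : (forall n, Cmod (u n - v) <= e n) -> is_lim_seq e 0 -> Cvg u v.
Proof.
  intros H He; apply (is_lim_seq_le_le (fun _ => 0) _ e).
  - intros n; split; [apply Cmod_ge_0|apply H].
  - apply is_lim_seq_const.
  - exact He.
Qed.

Lemma Cvg_spec u v : Cvg u v <->
  forall eps, 0 < eps -> exists N, forall n, (N <= n)%nat -> Cmod (u n - v) <= eps.
Proof.
  unfold Cvg; rewrite <- is_lim_seq_spec; simpl; split.
  - intros H eps He; destruct (H (mkposreal eps He)) as [N HN].
    exists N; intros n Hn; specialize (HN n Hn); simpl in HN.
    rewrite Rminus_0_r, Rabs_pos_eq in HN by apply Cmod_ge_0; lra.
  - intros H [eps He]; destruct (H (eps / 2)) as [N HN]; [lra|].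
    exists N; intros n Hn; specialize (HN n Hn); simpl.
    rewrite Rminus_0_r, Rabs_pos_eq by apply Cmod_ge_0; lra.
Qed.

Lemma Cvg_filterlim u v : Cvg u v <-> filterlim u eventually (locally v).
Proof.
  rewrite Cvg_spec, filterlim_locally; split.
  - intros H [eps He]; destruct (H (eps / 2)) as [N HN]; [lra|].
    exists N; intros n Hn; apply C_NormedModule_mixin_compat1; simpl.
    specialize (HN n Hn).
    change (Cmod (u n - v) < eps); lra.
  - intros H eps He.
    (* The balls of the uniform structure on [C] are controlled by the modulus only up to a factor
       [sqrt 2], so the radius is shrunk accordingly. *)
    assert (Hs : 0 < sqrt 2) by (apply sqrt_lt_R0; lra).
    assert (He' : 0 < eps / sqrt 2) by (now apply Rdiv_lt_0_compat).
    destruct (H (mkposreal _ He')) as [N HN]; exists N; intros n Hn.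
    pose proof (C_NormedModule_mixin_compat2 _ _ _ (HN n Hn)) as HC; simpl in HC.
    change (Cmod (u n - v) < sqrt 2 * (eps / sqrt 2)) in HC.
    replace (sqrt 2 * (eps / sqrt 2)) with eps in HC by (field; lra); lra.
Qed.

Lemma Cmod_minus_sym u v : Cmod (u - v) = Cmod (v - u).
Proof. rewrite <- Cmod_opp; f_equal; ring. Qed.

Lemma Cvg_bound_near u v w M : Cvg u v ->
  (exists N, forall n, (N <= n)%nat -> Cmod (u n - w) <= M) ->
  Cmod (v - w) <= M.
Proof.
  rewrite Cvg_spec; intros Hu [N HN]; apply Rle_plus_epsilon; intros eps He.
  destruct (Hu eps He) as [N' HN'].
  specialize (HN (max N N') ltac:(lia)); specialize (HN' (max N N') ltac:(lia)).
  replace (v - w)%C with ((v - u (max N N')) + (u (max N N') - w))%C by ring.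
  eapply Rle_trans; [apply Cmod_triangle|].
  rewrite (Cmod_minus_sym v); lra.
Qed.

Lemma Cvg_unique u v w : Cvg u v -> Cvg u w -> v = w.
Proof.
  intros Hv Hw.
  assert (H : Cmod (v - w) <= 0).
  { apply Rle_plus_epsilon; intros eps He; rewrite Rplus_0_l.
    apply (Cvg_bound_near u); [easy|].
    rewrite Cvg_spec in Hw; now apply Hw. }
  pose proof (Cmod_ge_0 (v - w)).
  assert (E : (v - w)%C = 0) by (apply Cmod_eq_0; lra).
  replace v with (v - w + w)%C by ring; rewrite E; ring.
Qed.

Lemma Cvg_bound u v M : Cvg u v -> (forall n, Cmod (u n) <= M) -> Cmod v <= M.
Proof.
  intros Hu HM; replace v with (v - 0)%C by ring.
  apply (Cvg_bound_near u); [easy|]; exists 0%nat; intros n _.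
  now replace (u n - 0)%C with (u n) by ring.
Qed.

Lemma Cvg_ext u u' v : (forall n, u n = u' n) -> Cvg u v -> Cvg u' v.
Proof. intros H; apply is_lim_seq_ext; intros n; now rewrite H. Qed.

Lemma Cvg_plus u v a b : Cvg u a -> Cvg v b -> Cvg (fun n => u n + v n)%C (a + b)%C.
Proof.
  intros Hu Hv; apply Cvg_squeeze with (fun n => Cmod (u n - a) + Cmod (v n - b)).
  - intros n; replace (u n + v n - (a + b))%C with ((u n - a) + (v n - b))%C by ring.
    apply Cmod_triangle.
  - replace (Finite 0) with (Finite (0 + 0)) by (f_equal; ring).
    now apply is_lim_seq_plus'.
Qed.

Lemma Cvg_mult u v a b : Cvg u a -> Cvg v b -> Cvg (fun n => u n * v n)%C (a * b)%C.
Proof.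
  intros Hu Hv.
  apply Cvg_squeeze with (fun n => Cmod (u n - a) * Cmod (v n - b)
    + (Cmod a * Cmod (v n - b) + Cmod b * Cmod (u n - a))).
  - intros n; replace (u n * v n - a * b)%C with
      ((u n - a) * (v n - b) + (a * (v n - b) + b * (u n - a)))%C by ring.
    eapply Rle_trans; [apply Cmod_triangle|]; rewrite Cmod_mult.
    apply Rplus_le_compat_l.
    eapply Rle_trans; [apply Cmod_triangle|]; rewrite !Cmod_mult; apply Rle_refl.
  - replace (Finite 0) with (Finite (0 * 0 + (Cmod a * 0 + Cmod b * 0)))
      by (f_equal; ring).
    apply is_lim_seq_plus'; [now apply is_lim_seq_mult'|].
    apply is_lim_seq_plus'; apply is_lim_seq_mult'; easy || apply is_lim_seq_const.
Qed.

Lemma Cvg_const c : Cvg (fun _ => c) c.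
Proof.
  apply Cvg_squeeze with (fun _ => 0); [|apply is_lim_seq_const].
  intros n; replace (c - c)%C with (RtoC 0) by ring; rewrite Cmod_0; lra.
Qed.

Lemma Cvg_minus u v a b : Cvg u a -> Cvg v b -> Cvg (fun n => u n - v n)%C (a - b)%C.
Proof.
  intros Hu Hv; replace (a - b)%C with (a + (- (1)) * b)%C by ring.
  apply Cvg_ext with (fun n => u n + (- (1)) * v n)%C; [intros n; ring|].
  apply Cvg_plus; [easy|]; apply Cvg_mult; [apply Cvg_const|easy].
Qed.

Lemma Cvg_near u v a : Cvg u a -> Cvg (fun n => v n - u n)%C 0 -> Cvg v a.
Proof.
  intros Hu Hv; replace a with (0 + a)%C by ring.
  apply Cvg_ext with (fun n => v n - u n + u n)%C; [intros n; ring|].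
  now apply Cvg_plus.
Qed.

Lemma Cauchy_Cvg (u : nat -> C) :
  (forall eps, 0 < eps -> exists N, forall n, (N <= n)%nat -> Cmod (u n - u N) <= eps) ->
  Cvg u (C_complete_lim (filtermap u eventually)).
Proof.
  intros H; apply Cvg_filterlim, filterlim_locally; intros eps.
  apply (C_complete_ax1 (filtermap u eventually)).
  - apply filtermap_proper_filter, eventually_filter.
  - intros [e He]; destruct (H (e / 2)) as [N HN]; [lra|].
    exists (u N); exists N; intros n Hn.
    apply C_NormedModule_mixin_compat1; simpl.
    specialize (HN n Hn); change (Cmod (u n - u N) < e); lra.
Qed.

(** * Partial sums and the evaluation map *)

Definition psum (x : nat * nat -> C) (s : C * C) (N : nat) : C :=
  lsum (Box N) (fun k => x k * chi s k)%C.

(** The completeness operator makes evaluation a total function, which can be written without a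
    convergence proof; [ev_correct] identifies it as the sum of the series for summable [x] and [s]
    in [H2]. *)
Definition ev (x : nat * nat -> C) (s : C * C) : C :=
  C_complete_lim (filtermap (psum x s) eventually).

Lemma psum_trunc x s M N : (M <= N)%nat -> psum (trunc M x) s N = psum x s M.
Proof.
  intros H; unfold psum; symmetry.
  rewrite (lsum_ext (Box M) _ (fun k => trunc M x k * chi s k)%C).
  - apply (lsum_support key_eq_dec); try apply NoDup_Box; [now apply Box_incl|].
    intros k _ Hk; unfold trunc.
    destruct (in_dec key_eq_dec k (Box M)); [easy|].
    change (0 * chi s k = 0)%C; ring.
  - intros k Hk; unfold trunc; now destruct (in_dec key_eq_dec k (Box M)).
Qed.

Lemma psum_bound x s A N : H2 s -> normle x A -> Cmod (psum x s N) <= A.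
Proof.
  intros Hs Hx; eapply Rle_trans; [apply Cmod_lsum|].
  eapply Rle_trans; [|apply (Hx N)]; apply Rsum_le; intros k Hk.
  apply in_Box in Hk; rewrite Cmod_mult.
  pose proof (Cmod_chi_le s k Hs (proj1 Hk)); pose proof (Cmod_ge_0 (x k)); nra.
Qed.

Lemma psum_plus x y s N : psum (fun k => x k + y k)%C s N = (psum x s N + psum y s N)%C.
Proof.
  unfold psum; rewrite <- Csum_plus; apply lsum_ext; intros k _; Cring.
Qed.

Lemma psum_minus x y s N : psum (fun k => x k - y k)%C s N = (psum x s N - psum y s N)%C.
Proof.
  unfold psum; rewrite <- Csum_minus; apply lsum_ext; intros k _; Cring.
Qed.

Lemma psum_scal c x s N : psum (fun k => c * x k)%C s N = (c * psum x s N)%C.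
Proof.
  unfold psum; rewrite <- Csum_scal; apply lsum_ext; intros k _; Cring.
Qed.

Lemma ev_correct x s : summable x -> H2 s -> Cvg (psum x s) (ev x s).
Proof.
  intros Hx Hs; apply Cauchy_Cvg; intros eps He.
  destruct (trunc_tail x eps Hx He) as [N HN]; exists N; intros n Hn.
  rewrite <- (psum_trunc x s N n), <- psum_minus by easy.
  apply psum_bound; auto.
Qed.

Lemma ev_bound x s A : H2 s -> normle x A -> Cmod (ev x s) <= A.
Proof.
  intros Hs Hx; apply (Cvg_bound (psum x s)).
  - apply ev_correct; [now exists A|easy].
  - intros n; now apply psum_bound.
Qed.

Lemma ev_plus x y s : summable x -> summable y -> H2 s ->
  ev (fun k => x k + y k)%C s = (ev x s + ev y s)%C.
Proof.
  intros Hx Hy Hs; apply (Cvg_unique (psum (fun k => x k + y k)%C s)).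
  - apply ev_correct; [now apply summable_plus|easy].
  - apply Cvg_ext with (fun N => psum x s N + psum y s N)%C.
    + intros N; now rewrite psum_plus.
    + apply Cvg_plus; now apply ev_correct.
Qed.

Lemma ev_minus x y s : summable x -> summable y -> H2 s ->
  ev (fun k => x k - y k)%C s = (ev x s - ev y s)%C.
Proof.
  intros Hx Hy Hs; apply (Cvg_unique (psum (fun k => x k - y k)%C s)).
  - apply ev_correct; [now apply summable_minus|easy].
  - apply Cvg_ext with (fun N => psum x s N - psum y s N)%C.
    + intros N; now rewrite psum_minus.
    + apply Cvg_minus; now apply ev_correct.
Qed.

Lemma summable_scal c x : summable x -> summable (fun k => c * x k)%C.
Proof.
  intros [A HA]; exists (Cmod c * A).
  apply normle_scal with x; [apply Cmod_ge_0| |easy].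
  intros k _; rewrite Cmod_mult; apply Rle_refl.
Qed.

Lemma ev_scal c x s : summable x -> H2 s -> ev (fun k => c * x k)%C s = (c * ev x s)%C.
Proof.
  intros Hx Hs; apply (Cvg_unique (psum (fun k => c * x k)%C s)).
  - apply ev_correct; [now apply summable_scal|easy].
  - apply Cvg_ext with (fun N => c * psum x s N)%C.
    + intros N; now rewrite psum_scal.
    + apply Cvg_mult; [apply Cvg_const|now apply ev_correct].
Qed.

Lemma ev_trunc N x s : summable x -> H2 s -> ev (trunc N x) s = psum x s N.
Proof.
  intros Hx Hs; apply (Cvg_unique (psum (trunc N x) s)).
  - apply ev_correct; [now apply summable_trunc|easy].
  - apply Cvg_spec; intros eps He; exists N; intros n Hn.
    rewrite psum_trunc by easy.
    replace (psum x s N - psum x s N)%C with (RtoC 0) by ring; rewrite Cmod_0; lra.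
Qed.

Lemma ev_kdelta s : H2 s -> ev kdelta s = RtoC 1.
Proof.
  intros Hs; apply (Cvg_unique (psum kdelta s)).
  - apply ev_correct; [exists 1; exact normle_kdelta|easy].
  - apply Cvg_spec; intros eps He; exists 1%nat; intros n Hn.
    replace (psum kdelta s n) with (RtoC 1).
    + replace (1 - 1)%C with (RtoC 0) by ring; rewrite Cmod_0; lra.
    + unfold psum; rewrite (lsum_single key_eq_dec (Box n) _ (1, 1)%nat).
      * unfold kdelta; destruct (key_eq_dec (1, 1)%nat (1, 1)%nat); [|easy].
        rewrite chi_one; Cring.
      * apply NoDup_Box.
      * apply in_Box; unfold kpos, kmax; simpl; lia.
      * intros k _ Hk; unfold kdelta; destruct (key_eq_dec k (1, 1)%nat); [easy|].
        change (0 * chi s k = 0)%C; ring.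
Qed.

(** The partial sum of the convolution collects exactly the pairs from [Box N] whose product stays
    in [Box N], while the product of partial sums collects all pairs from [Box N]. The difference is
    paid for by the tails of [x] and [y]. *)
Lemma psum_kconv_error x y s A B M N eps : H2 s -> (M * M <= N)%nat ->
  normle x A -> normle y B ->
  normle (fun k => x k - trunc M x k)%C eps -> normle (fun k => y k - trunc M y k)%C eps ->
  Cmod (psum (kconv x y) s N - psum x s N * psum y s N) <= eps * B + A * eps.
Proof.
  intros Hs HMN Hx Hy Hx' Hy'.
  assert (HM : (M <= N)%nat) by nia.
  assert (E : psum (kconv x y) s N = lsum (Box N) (fun u => lsum (Box N) (fun v =>
    if in_dec key_eq_dec (kmul u v) (Box N)
    then ((x u * chi s u) * (y v * chi s v))%C else (0 : C)))).
  { unfold psum.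
    transitivity (lsum (Box N) (fun k => lsum (Box N) (fun u => lsum (Box N) (fun v =>
      if key_eq_dec (kmul u v) k then ((x u * chi s u) * (y v * chi s v))%C else (0 : C))))).
    - apply lsum_ext; intros k Hk; apply in_Box in Hk.
      rewrite (kconv_Box x y k N), Cmult_comm by easy.
      rewrite <- Csum_scal; apply lsum_ext; intros u Hu.
      rewrite <- Csum_scal; apply lsum_ext; intros v Hv.
      apply in_Box in Hu; apply in_Box in Hv.
      destruct (key_eq_dec (kmul u v) k) as [<-|_]; [|Cring].
      rewrite chi_kmul by easy; Cring.
    (* With the sum over [k] innermost, a pair [u], [v] contributes once if its product lies in the
       box and not at all otherwise. *)
    - rewrite lsum_swap; apply lsum_ext; intros u _.
      rewrite lsum_swap; apply lsum_ext; intros v _.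
      destruct (in_dec key_eq_dec (kmul u v) (Box N)) as [Hi|Hi].
      + rewrite (lsum_single key_eq_dec (Box N) _ (kmul u v)).
        * now destruct (key_eq_dec (kmul u v) (kmul u v)).
        * apply NoDup_Box.
        * easy.
        * intros k _ Hk; destruct (key_eq_dec (kmul u v) k); [now subst|easy].
      + apply Csum_zero; intros k Hk.
        destruct (key_eq_dec (kmul u v) k); [now subst|easy]. }
  rewrite E; unfold psum; rewrite <- lsum_prod_C.
  rewrite <- Csum_minus.
  eapply Rle_trans; [apply Cmod_lsum|].
  (* A product uv leaving the box forces u or v out of the box of side M. *)
  apply Rle_trans with (lsum (Box N) (fun u => lsum (Box N) (fun v =>
    Cmod (x u - trunc M x u) * Cmod (y v) + Cmod (x u) * Cmod (y v - trunc M y v)))).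
  - apply Rsum_le; intros u Hu; rewrite <- Csum_minus.
    eapply Rle_trans; [apply Cmod_lsum|]; apply Rsum_le; intros v Hv.
    pose proof (Cmod_ge_0 (x u)); pose proof (Cmod_ge_0 (y v)).
    assert (Hnn : 0 <= Cmod (x u - trunc M x u) * Cmod (y v) +
                       Cmod (x u) * Cmod (y v - trunc M y v)).
    { apply Rplus_le_le_0_compat; apply Rmult_le_pos; apply Cmod_ge_0. }
    destruct (in_dec key_eq_dec (kmul u v) (Box N)) as [Hi|Hi].
    + replace (x u * chi s u * (y v * chi s v) - x u * chi s u * (y v * chi s v))%C
        with (RtoC 0) by ring.
      now rewrite Cmod_0.
    + assert (Hb : Cmod (0 - x u * chi s u * (y v * chi s v)) <= Cmod (x u) * Cmod (y v)).
      { replace (0 - x u * chi s u * (y v * chi s v))%C with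
          (- ((x u * y v) * chi s (kmul u v)))%C.
        - rewrite Cmod_opp, !Cmod_mult.
          rewrite <- (Rmult_1_r (Cmod (x u) * Cmod (y v))) at 2.
          apply Rmult_le_compat_l; [now apply Rmult_le_pos|].
          apply Cmod_chi_le; [easy|].
          apply in_Box in Hu; apply in_Box in Hv; now apply kmul_pos.
        - rewrite chi_kmul; [ring| |]; [now apply in_Box in Hu|now apply in_Box in Hv]. }
      eapply Rle_trans; [exact Hb|].
      unfold trunc in *.
      destruct (in_dec key_eq_dec u (Box M)) as [Iu|Iu];
        destruct (in_dec key_eq_dec v (Box M)) as [Iv|Iv].
      * exfalso; apply Hi; now apply kmul_in_Box with M.
      * replace (y v - 0)%C with (y v) by ring.
        pose proof (Cmod_ge_0 (x u - x u)); nra.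
      * replace (x u - 0)%C with (x u) by ring.
        pose proof (Cmod_ge_0 (y v - y v)); nra.
      * replace (x u - 0)%C with (x u) by ring.
        pose proof (Cmod_ge_0 (y v - 0)); nra.
  - erewrite (lsum_ext (Box N)).
    2:{ intros u _; apply Rsum_plus. }
    rewrite Rsum_plus, !lsum_prod_R.
    assert (P : forall z : nat * nat -> C, 0 <= lsum (Box N) (fun k => Cmod (z k))).
    { intros z; apply Rsum_nonneg; intros; apply Cmod_ge_0. }
    apply Rplus_le_compat; apply Rmult_le_compat; auto;
      try (apply (P (fun k => x k - trunc M x k)%C));
      try (apply (P (fun k => y k - trunc M y k)%C)).
Qed.

Lemma ev_kconv x y s : summable x -> summable y -> H2 s ->
  ev (kconv x y) s = (ev x s * ev y s)%C.
Proof.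
  intros Hx Hy Hs; apply (Cvg_unique (psum (kconv x y) s)).
  { apply ev_correct; [now apply summable_kconv|easy]. }
  apply (Cvg_near (fun N => psum x s N * psum y s N)%C).
  { apply Cvg_mult; now apply ev_correct. }
  destruct Hx as [A HA], Hy as [B HB].
  pose proof (normle_nonneg _ _ HA); pose proof (normle_nonneg _ _ HB).
  apply Cvg_spec; intros eps He.
  (* Chosen so that [e * B + A * e] is at most [eps]; the summand 1 keeps the denominator
     positive. *)
  set (e := eps / (A + B + 1)).
  assert (He' : 0 < e) by (apply Rdiv_lt_0_compat; lra).
  destruct (trunc_tail x e) as [M1 HM1]; [now exists A|easy|].
  destruct (trunc_tail y e) as [M2 HM2]; [now exists B|easy|].
  set (M := max M1 M2).
  (* The product of two members of [Box M] lies in [Box (M * M)]. *)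
  exists (M * M)%nat; intros n Hn.
  replace (psum (kconv x y) s n - psum x s n * psum y s n - 0)%C with
    (psum (kconv x y) s n - psum x s n * psum y s n)%C by ring.
  eapply Rle_trans.
  - apply (psum_kconv_error x y s A B M n e); try easy;
      [apply HM1|apply HM2]; unfold M; lia.
  - assert (E : e * (A + B + 1) = eps) by (unfold e; field; lra).
    nra.
Qed.

Lemma ev_kpow x n s : summable x -> H2 s -> ev (kpow x n) s = (ev x s ^ n)%C.
Proof.
  intros Hx Hs; induction n as [|n IH]; simpl.
  - now apply ev_kdelta.
  - rewrite ev_kconv, IH; [easy|easy|now apply summable_kpow|easy].
Qed.

(** * Coefficient bound and uniqueness *)

Lemma inH_plus s t : inH s -> inH t -> inH (s + t)%C.
Proof. destruct s, t; unfold inH, Re; simpl; lra. Qed.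

Lemma H2_splus s t : H2 s -> H2 t -> H2 (splus s t).
Proof. intros [] []; split; now apply inH_plus. Qed.

Lemma npow_neg_0 n : npow_neg n 0 = RtoC 1.
Proof.
  unfold npow_neg, RtoC, Re, Im; simpl.
  rewrite Ropp_0, !Rmult_0_l, exp_0, cos_0, sin_0; f_equal; ring.
Qed.

(** On the imaginary axis only the phases [t * ln m] and [t * ln n] matter. The chosen [t] makes
    them differ by [PI]; it is well defined because [ln] is injective. *)
Lemma npow_neg_opposite m n : (1 <= m)%nat -> (1 <= n)%nat -> m <> n ->
  exists t, npow_neg m (0, t) = (- npow_neg n (0, t))%C.
Proof.
  intros Hm Hn Hmn; exists (PI / (ln (INR m) - ln (INR n))).
  set (t := PI / _).
  assert (E : t * ln (INR m) = t * ln (INR n) + PI).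
  { unfold t; field; intros H; apply Hmn, INR_eq, ln_inv; try (apply lt_0_INR; lia); lra. }
  unfold npow_neg, Copp, Re, Im; simpl.
  rewrite E, neg_cos, neg_sin, Ropp_0, !Rmult_0_l, exp_0; f_equal; ring.
Qed.

(** An imaginary translation in one coordinate where [k] and [k0] differ suffices; being imaginary,
    it keeps all moduli equal to 1. *)
Lemma chi_opposite k k0 : kpos k -> kpos k0 -> k <> k0 ->
  exists h, H2 h /\ Cmod (chi h k0) = 1 /\ chi h k = (- chi h k0)%C.
Proof.
  destruct k as [m n], k0 as [m0 n0]; unfold kpos, chi; simpl; intros [Hm Hn] [Hm0 Hn0] Hne.
  assert (U : forall p t, Cmod (npow_neg p (0, t)) = 1).
  { intros p t; rewrite Cmod_npow_neg; unfold Re; simpl.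
    now rewrite Ropp_0, Rmult_0_l, exp_0. }
  destruct (Nat.eq_dec m m0) as [<-|Hmm].
  - assert (Hnn : n <> n0) by (intros ->; easy).
    destruct (npow_neg_opposite n n0 Hn Hn0 Hnn) as [t Ht].
    exists ((0, 0), (0, t)); simpl; repeat split; try (unfold inH, Re; simpl; lra).
    + rewrite Cmod_mult, !U; ring.
    + rewrite Ht; ring.
  - destruct (npow_neg_opposite m m0 Hm Hm0 Hmm) as [t Ht].
    exists ((0, t), (0, 0)); simpl; repeat split; try (unfold inH, Re; simpl; lra).
    + rewrite Cmod_mult, !U; ring.
    + rewrite Ht; change (0, 0) with (RtoC 0); rewrite !npow_neg_0; ring.
Qed.

(* If chi h k = - chi h k0, then (f(s) + f(s + h) / chi h k0) / 2 obeys the same bound as f, has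
   the same coefficient at k0, and has none at k. *)
Lemma coef_bound_list k0 M : kpos k0 -> forall (l : list (nat * nat)) (c : nat * nat -> C),
  (forall k, In k l -> kpos k /\ k <> k0) ->
  (forall s, H2 s -> Cmod (c k0 * chi s k0 + lsum l (fun k => c k * chi s k)%C) <= M) ->
  Cmod (c k0) <= M.
Proof.
  intros H0; induction l as [|k l IH]; intros c Hl Hb.
  - specialize (Hb (RtoC 0, RtoC 0)).
    unfold chi in Hb; simpl in Hb; rewrite !npow_neg_0 in Hb.
    replace (c k0) with (c k0 * (1 * 1) + 0)%C by ring.
    apply Hb; unfold H2, inH, Re; simpl; lra.
  - destruct (Hl k) as [Hk Hkk]; [now left|].
    destruct (chi_opposite k k0 Hk H0 Hkk) as [h [Hh [Hw Eh]]].
    set (w := chi h k0) in *.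
    assert (Hw0 : w <> 0) by (apply Cmod_gt_0; lra).
    assert (H20 : RtoC 2 <> 0) by (intros E; apply (f_equal fst) in E; simpl in E; lra).
    set (c' := fun j => (c j * ((1 + chi h j / w) / 2))%C).
    replace (c k0) with (c' k0) by (unfold c'; fold w; field; auto).
    apply IH; [intros j Hj; apply Hl; now right|].
    intros s Hs.
    set (f := fun s => (c k0 * chi s k0 + lsum (k :: l) (fun k => c k * chi s k))%C) in Hb.
    assert (T : forall j s, (c' j * chi s j =
      / 2 * (c j * chi s j) + (/ 2 * / w) * (c j * chi (splus s h) j))%C).
    { intros j s'; unfold c'; rewrite chi_splus; field; auto. }
    replace (c' k0 * chi s k0 + lsum l (fun k => c' k * chi s k))%C
      with (/ 2 * f s + (/ 2 * / w) * f (splus s h))%C.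
    + eapply Rle_trans; [apply Cmod_triangle|].
      rewrite !Cmod_mult, !Cmod_inv, Hw, Cmod_R, Rabs_pos_eq by (easy || lra).
      pose proof (Hb s Hs) as B1.
      pose proof (Hb (splus s h) (H2_splus _ _ Hs Hh)) as B2.
      unfold f at 1 2; lra.
    + assert (EL : lsum l (fun k => c' k * chi s k)%C =
        (/ 2 * lsum l (fun k => c k * chi s k) +
         (/ 2 * / w) * lsum l (fun k => c k * chi (splus s h) k))%C).
      { rewrite <- !Csum_scal, <- Csum_plus; apply lsum_ext; intros j _; apply T. }
      rewrite EL, T; unfold f; simpl.
      change plus with Cplus.
      rewrite (chi_splus s h k), Eh; field; auto.
Qed.

(** Truncating to a large enough box containing [k] changes the transform by at most [eps], so the
    finite case gives the bound [M + eps] for every [eps]. *)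
Lemma coef_bound x k M : summable x -> kpos k ->
  (forall s, H2 s -> Cmod (ev x s) <= M) -> Cmod (x k) <= M.
Proof.
  intros Hx Hk HM; apply Rle_plus_epsilon; intros eps He.
  destruct (trunc_tail x eps Hx He) as [N0 HN0].
  set (N := max N0 (kmax k)); specialize (HN0 N ltac:(unfold N; lia)).
  assert (Hin : In k (Box N)) by (apply in_Box; unfold N; split; [easy|lia]).
  (* The box is reordered with [k] in front; as it has no duplicates, the remaining indices differ
     from [k]. *)
  destruct (in_split _ _ Hin) as [l1 [l2 El]].
  assert (HP : Permutation (Box N) (k :: (l1 ++ l2))).
  { rewrite El; symmetry; apply Permutation_middle. }
  apply (coef_bound_list k _ Hk (l1 ++ l2)).
  - intros j Hj; split.
    + apply (in_Box j N); rewrite HP; now right.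
    + intros ->; pose proof (NoDup_Box N) as HD; rewrite El in HD.
      now apply NoDup_remove_2 in HD.
  - intros s Hs.
    change (Cmod (lsum (k :: (l1 ++ l2)) (fun k => x k * chi s k)%C) <= M + eps).
    rewrite <- (lsum_perm _ _ _ HP); fold (psum x s N).
    rewrite <- ev_trunc by easy.
    replace (ev (trunc N x) s) with (ev x s - (ev x s - ev (trunc N x) s))%C by ring.
    rewrite <- ev_minus by (try apply summable_trunc; easy).
    unfold Cminus at 1; eapply Rle_trans; [apply Cmod_triangle|]; rewrite Cmod_opp.
    apply Rplus_le_compat; [now apply HM|now apply ev_bound].
Qed.

(** The coefficient bound with [M = 0] is applied to the difference. Algebraic laws of convolution,
    such as associativity and commutativity, are from here on replaced by [ring] on transforms. *)
Lemma ev_inj x y : summable x -> summable y ->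
  (forall s, H2 s -> ev x s = ev y s) -> forall k, kpos k -> x k = y k.
Proof.
  intros Hx Hy H k Hk.
  assert (E : Cmod (x k - y k) <= 0).
  { apply (coef_bound (fun k => x k - y k)%C); [now apply summable_minus|easy|].
    intros s Hs; rewrite ev_minus, H by easy.
    replace (ev y s - ev y s)%C with (RtoC 0) by ring; rewrite Cmod_0; lra. }
  pose proof (Cmod_ge_0 (x k - y k)).
  assert (E' : (x k - y k)%C = 0) by (apply Cmod_eq_0; lra).
  replace (x k) with (x k - y k + y k)%C by ring; rewrite E'; ring.
Qed.

(** * Spectral radius *)

(* Contains every product of j factors taken from 1, ..., N, and has only (j + 1)^N entries. *)
Fixpoint products (N j : nat) : list nat :=
  match N with
  | O => 1%nat :: nil
  | S N' => map (fun p => fst p * S N' ^ snd p)%nat (list_prod (products N' j) (seq 0 (S j)))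
  end.

Lemma products_length N j : length (products N j) = (S j ^ N)%nat.
Proof.
  induction N as [|N IH]; [easy|].
  change (length (map (fun p => fst p * S N ^ snd p)%nat
    (list_prod (products N j) (seq 0 (S j)))) = (S j ^ S N)%nat).
  rewrite length_map, length_prod, IH, length_seq, Nat.pow_succ_r'; lia.
Qed.

Lemma in_products_S n N j : In n (products (S N) j) <->
  exists p e, In p (products N j) /\ (e <= j)%nat /\ n = (p * S N ^ e)%nat.
Proof.
  change (products (S N) j) with (map (fun p => fst p * S N ^ snd p)%nat
    (list_prod (products N j) (seq 0 (S j)))).
  rewrite in_map_iff; split.
  - intros [[p e] [E Hin]]; apply in_prod_iff in Hin; rewrite in_seq in Hin.
    exists p, e; repeat split; [easy|lia|easy].
  - intros [p [e [Hp [He E]]]]; exists (p, e); split; [easy|].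
    apply in_prod_iff; rewrite in_seq; split; [easy|lia].
Qed.

Lemma one_in_products N j : In 1%nat (products N j).
Proof.
  induction N as [|N IH]; [now left|].
  apply in_products_S; exists 1%nat, 0%nat; simpl; repeat split; [easy|lia].
Qed.

Lemma products_mono N j n : In n (products N j) -> In n (products N (S j)).
Proof.
  revert n; induction N as [|N IH]; intros n; [easy|].
  rewrite !in_products_S; intros [p [e [Hp [He E]]]].
  exists p, e; repeat split; [now apply IH|lia|easy].
Qed.

(** Induction on the largest admissible factor: if [u] is [S N], the last exponent grows by one;
    otherwise [u] is absorbed into the part [p] built from smaller factors. *)
Lemma products_mul N j u n : (1 <= u <= N)%nat -> In n (products N j) ->
  In (u * n)%nat (products N (S j)).
Proof.
  revert u n; induction N as [|N IH]; intros u n Hu; [lia|].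
  rewrite !in_products_S; intros [p [e [Hp [He E]]]].
  destruct (Nat.eq_dec u (S N)) as [->|Hne].
  - exists p, (S e); repeat split; [now apply products_mono|lia|].
    rewrite E, Nat.pow_succ_r'; ring.
  - exists (u * p)%nat, e; repeat split; [apply IH; [lia|easy]|lia|].
    rewrite E; ring.
Qed.

(** A point carrying a nonzero coefficient of the next power is a point of [Box N] times one of the
    previous support, so [products_mul] applies in each coordinate. *)
Lemma kpow_support N (x : nat * nat -> C) j k : (forall u, ~ In u (Box N) -> x u = 0) ->
  ~ In k (list_prod (products N j) (products N j)) -> kpow x j k = 0.
Proof.
  intros Hx; revert k; induction j as [|j IH]; intros k Hk; simpl.
  - unfold kdelta; destruct (key_eq_dec k (1, 1)%nat) as [->|]; [|easy].
    exfalso; apply Hk, in_prod; apply one_in_products.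
  - unfold kconv; apply Csum_zero; intros u Hu; apply Csum_zero; intros v Hv.
    destruct (key_eq_dec (kmul u v) k) as [E|]; [|easy].
    destruct (in_dec key_eq_dec u (Box N)) as [Iu|Iu].
    2:{ rewrite Hx by easy; ring. }
    destruct (in_dec key_eq_dec v (list_prod (products N j) (products N j))) as [Iv|Iv].
    2:{ rewrite IH by easy; ring. }
    exfalso; apply Hk; rewrite <- E.
    destruct u as [u1 u2], v as [v1 v2]; apply in_prod_iff in Iv.
    apply in_Box in Iu; unfold kpos, kmax in Iu; simpl in Iu.
    unfold kmul; simpl; apply in_prod; apply products_mul; easy || lia.
Qed.

Lemma normle_finite_support (x : nat * nat -> C) l c : 0 <= c -> (forall k, ~ In k l -> x k = 0) ->
  (forall k, kpos k -> Cmod (x k) <= c) -> normle x (INR (length l) * c).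
Proof.
  intros Hc Hl Hx N.
  set (p := fun k => if in_dec key_eq_dec k l then true else false).
  rewrite <- (lsum_filter p).
  - apply Rle_trans with (lsum (filter p (Box N)) (fun _ => c)).
    + apply Rsum_le; intros k Hk; apply filter_In in Hk; apply Hx.
      now apply (in_Box k N).
    + rewrite Rsum_const; apply Rmult_le_compat_r; [easy|].
      apply le_INR, NoDup_incl_length; [apply NoDup_filter, NoDup_Box|].
      intros k Hk; apply filter_In in Hk; unfold p in Hk.
      destruct (in_dec key_eq_dec k l); easy.
  - intros k _; unfold p; destruct (in_dec key_eq_dec k l); [easy|].
    intros _; rewrite Hl by easy; exact Cmod_0.
Qed.

(** Bernoulli's inequality for [1 + h = / t] gives [1 + j * h <= / t ^ j], and [1 + j] is at most
    [1 + / h] times the left side. The case [t = 0] is separate because of the division. *)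
Lemma linear_geom_bounded t : 0 <= t < 1 -> exists K, forall j, INR (S j) * t ^ j <= K.
Proof.
  intros [Ht0 Ht1].
  destruct (Req_dec t 0) as [->|Hne].
  { exists 1; intros [|j]; simpl; [lra|].
    rewrite Rmult_0_l, Rmult_0_r; lra. }
  set (h := / t - 1).
  assert (Hh : 0 < h).
  { unfold h; apply Rlt_0_minus; rewrite <- Rinv_1; apply Rinv_lt_contravar; lra. }
  exists (1 + / h); intros j.
  assert (HB := poly j h Hh).
  replace (1 + h) with (/ t) in HB by (unfold h; ring).
  rewrite pow_inv in HB.
  assert (Htj : 0 < t ^ j) by (apply pow_lt; lra).
  apply (Rmult_le_reg_r (/ t ^ j)); [now apply Rinv_0_lt_compat|].
  replace (INR (S j) * t ^ j * / t ^ j) with (INR (S j)) by (field; lra).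
  rewrite S_INR; pose proof (pos_INR j).
  assert (Hih : 0 < / h) by now apply Rinv_0_lt_compat.
  apply Rle_trans with ((1 + / h) * (1 + INR j * h)).
  - replace ((1 + / h) * (1 + INR j * h)) with (1 + INR j * h + / h + INR j) by (field; lra).
    nra.
  - apply Rmult_le_compat_l; lra.
Qed.

(** Writing [t ^ j] as the square of [sqrt t ^ j], one factor absorbs a single [INR (S j)] and the
    other absorbs the remaining power by induction. *)
Lemma poly_geom_bounded D t : 0 <= t < 1 -> exists K, forall j, INR (S j) ^ D * t ^ j <= K.
Proof.
  revert t; induction D as [|D IH]; intros t Ht.
  - exists 1; intros j; simpl; rewrite Rmult_1_l.
    rewrite <- (pow1 j); apply pow_incr; lra.
  - assert (Hs : 0 <= sqrt t < 1).
    { split; [apply sqrt_pos|]; rewrite <- sqrt_1; apply sqrt_lt_1; lra. }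
    destruct (IH _ Hs) as [K HK]; destruct (linear_geom_bounded _ Hs) as [K1 HK1].
    exists (K1 * K); intros j.
    replace (INR (S j) ^ S D * t ^ j) with
      ((INR (S j) * sqrt t ^ j) * (INR (S j) ^ D * sqrt t ^ j)).
    + apply Rmult_le_compat; auto; apply Rmult_le_pos; try apply pow_le; try apply pos_INR; lra.
    + assert (E : t ^ j = sqrt t ^ j * sqrt t ^ j).
      { rewrite <- Rpow_mult_distr, sqrt_sqrt by lra; easy. }
      rewrite E, <- tech_pow_Rmult; ring.
Qed.

(** Each coefficient of the [j]-th power is at most [q ^ j] by [coef_bound], and the support has
    polynomial size in [j]; the factor [(q / r) ^ j] swallows that polynomial. *)
Lemma kpow_finite_growth N (x : nat * nat -> C) q r : summable x ->
  (forall u, ~ In u (Box N) -> x u = 0) ->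
  (forall s, H2 s -> Cmod (ev x s) <= q) -> q < r ->
  exists K, forall j, normle (kpow x j) (K * r ^ j).
Proof.
  intros Hx Hs Hq Hqr.
  assert (Hq0 : 0 <= q).
  { eapply Rle_trans; [apply Cmod_ge_0|apply (Hq (RtoC 0, RtoC 0))].
    unfold H2, inH, Re; simpl; lra. }
  assert (Ht : 0 <= q / r < 1).
  { split; [apply Rle_mult_inv_pos; lra|].
    apply (Rmult_lt_reg_r r); [lra|]; field_simplify; lra. }
  (* One factor [(j + 1) ^ N] comes from each of the two coordinates. *)
  destruct (poly_geom_bounded (N + N) _ Ht) as [K HK].
  exists K; intros j.
  apply normle_weaken with (INR (length (list_prod (products N j) (products N j))) * q ^ j).
  - apply normle_finite_support; [now apply pow_le|intros k; now apply kpow_support|].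
    intros k Hk; apply coef_bound; [now apply summable_kpow|easy|].
    intros s Hss; rewrite ev_kpow, Cmod_pow by easy.
    apply pow_incr; split; [apply Cmod_ge_0|auto].
  - rewrite length_prod, products_length, mult_INR, pow_INR, <- pow_add.
    replace (q ^ j) with ((q / r) ^ j * r ^ j).
    + rewrite <- Rmult_assoc; apply Rmult_le_compat_r; [apply pow_le; lra|apply HK].
    + rewrite <- Rpow_mult_distr; f_equal; field; lra.
Qed.

(** One factor [z] is split as [y + (z - y)]: the first part raises the power of [y], the second
    costs [eps]. This is the binomial expansion by induction on [n], and it needs the bound for all
    [j] at once. *)
Lemma kpow_perturb_bound z y K r eps : summable z -> summable y -> 0 <= r ->
  (forall j, normle (kpow y j) (K * r ^ j)) -> normle (fun k => z k - y k)%C eps ->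
  forall n j, normle (kconv (kpow z n) (kpow y j)) (K * r ^ j * (r + eps) ^ n).
Proof.
  intros Hz Hy Hr HK Heps; induction n as [|n IH]; intros j.
  - rewrite pow_O, Rmult_1_r; apply normle_ext with (kpow y j); [|apply HK].
    assert (Sd := summable_kpow z 0 Hz); assert (Sy := summable_kpow y j Hy).
    apply ev_inj; [now apply summable_kconv|easy|].
    intros s Hs; rewrite ev_kconv, !ev_kpow by easy; simpl; ring.
  - assert (Sz := fun m => summable_kpow z m Hz); assert (Sy := fun m => summable_kpow y m Hy).
    assert (Sd := summable_minus z y Hz Hy).
    assert (Szy := fun m i => summable_kconv _ _ (Sz m) (Sy i)).
    apply normle_ext with (fun k => kconv (kpow z n) (kpow y (S j)) k +
      kconv (fun k => z k - y k) (kconv (kpow z n) (kpow y j)) k)%C.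
    + apply ev_inj; [auto|apply summable_plus; [auto|now apply summable_kconv]|].
      intros s Hs; rewrite ev_plus by (auto; now apply summable_kconv).
      rewrite (ev_kconv (fun k => z k - y k)%C) by auto.
      rewrite ev_minus, !ev_kconv, !ev_kpow by auto; simpl; ring.
    + apply normle_weaken with
        (K * r ^ S j * (r + eps) ^ n + eps * (K * r ^ j * (r + eps) ^ n)).
      * apply normle_plus; [apply IH|]; now apply normle_kconv.
      * simpl; right; ring.
Qed.

Lemma kpow_geometric z q : summable z -> (forall s, H2 s -> Cmod (ev z s) <= q) -> q < 1 ->
  exists K r, 0 <= r < 1 /\ forall n, normle (kpow z n) (K * r ^ n).
Proof.
  intros Hz Hq Hq1.
  assert (Hq0 : 0 <= q).
  { eapply Rle_trans; [apply Cmod_ge_0|apply (Hq (RtoC 0, RtoC 0))].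
    unfold H2, inH, Re; simpl; lra. }
  (* Three losses of size [e] occur: truncation raises the supremum to [q + e], the growth lemma
     needs a strictly larger rate [q + 2 * e], and the perturbation adds another [e]. The total
     stays below 1. *)
  set (e := (1 - q) / 4); assert (He : 0 < e) by (unfold e; lra).
  destruct (trunc_tail z e Hz He) as [N HN]; specialize (HN N (le_n N)).
  assert (Hy := summable_trunc N z Hz).
  destruct (kpow_finite_growth N (trunc N z) (q + e) (q + 2 * e)) as [K HK].
  - easy.
  - intros u Hu; unfold trunc; now destruct (in_dec key_eq_dec u (Box N)).
  - intros s Hs.
    replace (ev (trunc N z) s) with (ev z s - (ev z s - ev (trunc N z) s))%C by ring.
    rewrite <- ev_minus by easy.
    unfold Cminus at 1; eapply Rle_trans; [apply Cmod_triangle|]; rewrite Cmod_opp.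
    apply Rplus_le_compat; [now apply Hq|now apply ev_bound].
  - lra.
  - exists K, (q + 2 * e + e); split; [unfold e in *; lra|]; intros n.
    assert (Sz := summable_kpow z n Hz).
    (* The power of [z] is the case [j = 0] of the perturbation bound. *)
    apply normle_ext with (kconv (kpow z n) (kpow (trunc N z) 0)).
    + assert (Sd := summable_kpow (trunc N z) 0 Hy).
      apply ev_inj; [easy|now apply summable_kconv|].
      intros s Hs; rewrite ev_kconv, !ev_kpow by easy; simpl; ring.
    + rewrite <- (Rmult_1_r K), <- (pow_O (q + 2 * e)).
      apply kpow_perturb_bound; easy || lra.
Qed.

(** * Neumann series and invertibility *)

Fixpoint neumann (z : nat * nat -> C) (n : nat) (k : nat * nat) : C :=
  match n with
  | O => 0
  | S n' => (neumann z n' k + kpow z n' k)%C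
  end.

Lemma summable_neumann z n : summable z -> summable (neumann z n).
Proof.
  intros Hz; induction n as [|n IH].
  - exists 0; intros N; apply Req_le, Rsum_zero; intros k _; exact Cmod_0.
  - apply (summable_plus (neumann z n) (kpow z n)); [easy|now apply summable_kpow].
Qed.

Lemma ev_neumann z n s : summable z -> H2 s ->
  (ev (neumann z n) s * (1 - ev z s) = 1 - ev z s ^ n)%C.
Proof.
  intros Hz Hs; induction n as [|n IH].
  - assert (E : ev (neumann z 0) s = 0).
    { apply Cmod_eq_0, Rle_antisym; [|apply Cmod_ge_0].
      apply ev_bound; [easy|]; intros N; apply Req_le, Rsum_zero; intros k _; exact Cmod_0. }
    rewrite E; simpl; ring.
  - assert (E : ev (neumann z (S n)) s = (ev (neumann z n) s + ev z s ^ n)%C).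
    { rewrite <- ev_kpow by easy.
      apply ev_plus; [now apply summable_neumann|now apply summable_kpow|easy]. }
    rewrite E; replace ((ev (neumann z n) s + ev z s ^ n) * (1 - ev z s))%C
      with (ev (neumann z n) s * (1 - ev z s) + ev z s ^ n * (1 - ev z s))%C by ring.
    rewrite IH; simpl; ring.
Qed.

Lemma neumann_tail z K r N d : 0 <= r < 1 -> (forall n, normle (kpow z n) (K * r ^ n)) ->
  normle (fun k => neumann z (d + N) k - neumann z N k)%C (K * r ^ N / (1 - r)).
Proof.
  intros Hr HK.
  assert (HK0 : 0 <= K).
  { pose proof (normle_nonneg _ _ (HK 0%nat)) as H; simpl in H; lra. }
  (* The induction on [d] runs on the exact finite geometric sum; only afterwards is the factor
     [1 - r ^ d] dropped. *)
  apply normle_weaken with (K * r ^ N * (1 - r ^ d) / (1 - r)).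
  - induction d as [|d IH]; simpl.
    + replace (K * r ^ N * (1 - 1) / (1 - r)) with 0 by (field; lra).
      intros M; apply Req_le, Rsum_zero; intros k _.
      replace (neumann z N k - neumann z N k)%C with (RtoC 0) by ring; exact Cmod_0.
    + apply normle_ext with (fun k => (neumann z (d + N) k - neumann z N k)
        + kpow z (d + N) k)%C; [intros k _; ring|].
      eapply normle_weaken; [apply normle_plus; [apply IH|apply HK]|].
      right; rewrite pow_add; field; lra.
  - unfold Rdiv; apply Rmult_le_compat_r; [apply Rlt_le, Rinv_0_lt_compat; lra|].
    assert (0 <= r ^ N) by (apply pow_le; lra).
    assert (0 <= r ^ d) by (apply pow_le; lra).
    assert (0 <= K * r ^ N) by now apply Rmult_le_pos.
    nra.
Qed.

(** A box sum has finitely many terms, so pointwise convergence suffices to pass the bound to the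
    limit. *)
Lemma normle_limit (u : nat -> nat * nat -> C) w A :
  (forall k, kpos k -> Cvg (fun n => u n k) (w k)) -> (forall n, normle (u n) A) -> normle w A.
Proof.
  intros Hc Hu N.
  assert (L : is_lim_seq (fun n => lsum (Box N) (fun k => Cmod (u n k - w k))) 0).
  { assert (HB : forall k, In k (Box N) -> kpos k) by (intros k Hk; now apply in_Box in Hk).
    induction (Box N) as [|k l IH]; simpl.
    - apply is_lim_seq_const.
    - replace (Finite 0) with (Finite (0 + 0)) by (f_equal; ring).
      apply (is_lim_seq_plus' (fun n => Cmod (u n k - w k))).
      + apply Hc, HB; now left.
      + apply IH; intros j Hj; apply HB; now right. }
  change (Rbar_le (lsum (Box N) (fun k => Cmod (w k))) A).
  apply (is_lim_seq_le (fun _ => lsum (Box N) (fun k => Cmod (w k)))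
    (fun n => lsum (Box N) (fun k => Cmod (u n k - w k)) + A)).
  - intros n; apply Rle_trans with (lsum (Box N) (fun k => Cmod (u n k - w k))
      + lsum (Box N) (fun k => Cmod (u n k))).
    + rewrite <- Rsum_plus; apply Rsum_le; intros k _.
      replace (w k) with (- (u n k - w k) + u n k)%C at 1 by ring.
      rewrite <- (Cmod_opp (u n k - w k)); apply Cmod_triangle.
    + apply Rplus_le_compat_l, Hu.
  - apply is_lim_seq_const.
  - replace (Finite A) with (Finite (0 + A)) by (f_equal; ring).
    apply is_lim_seq_plus'; [easy|apply is_lim_seq_const].
Qed.

(** Invertibility in the algebra is read off the transforms; by [ev_inj] this amounts to the
    convolution identity with [kdelta]. *)
Definition invertible (x : nat * nat -> C) : Prop :=
  exists b, summable b /\ forall s, H2 s -> (ev x s * ev b s = 1)%C.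

Lemma geom_small K r eps : 0 <= r < 1 -> 0 < eps -> 0 <= K ->
  exists N, forall n, (N <= n)%nat -> K * r ^ n <= eps.
Proof.
  intros Hr He HK.
  assert (L : is_lim_seq (fun n => K * r ^ n) 0).
  { replace (Finite 0) with (Finite (K * 0)) by (f_equal; ring).
    apply is_lim_seq_mult'; [apply is_lim_seq_const|].
    apply is_lim_seq_geom; rewrite Rabs_pos_eq; lra. }
  apply is_lim_seq_spec in L; destruct (L (mkposreal eps He)) as [N HN].
  exists N; intros n Hn; specialize (HN n Hn); simpl in HN.
  rewrite Rminus_0_r in HN; apply Rabs_def2 in HN; lra.
Qed.

Lemma invertible_one_minus z q : summable z -> (forall s, H2 s -> Cmod (ev z s) <= q) -> q < 1 ->
  exists w, summable w /\ forall s, H2 s -> ((1 - ev z s) * ev w s = 1)%C.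
Proof.
  intros Hz Hq Hq1.
  destruct (kpow_geometric z q Hz Hq Hq1) as [K [r [Hr HK]]].
  assert (HK0 : 0 <= K).
  { pose proof (normle_nonneg _ _ (HK 0%nat)) as H; simpl in H; lra. }
  assert (HK1 : 0 <= K / (1 - r)) by (apply Rle_mult_inv_pos; lra).
  assert (small : forall eps, 0 < eps -> exists N, forall n, (N <= n)%nat ->
    K * r ^ n / (1 - r) <= eps).
  { intros eps He; destruct (geom_small _ r eps Hr He HK1) as [N HN].
    exists N; intros n Hn; specialize (HN n Hn).
    replace (K * r ^ n / (1 - r)) with (K / (1 - r) * r ^ n) by (field; lra); easy. }
  (* The sum of the Neumann series is taken coefficient by coefficient; the uniform tail bound then
     shows that the convergence also holds in norm. *)
  set (w := fun k : nat * nat => C_complete_lim (filtermap (fun n => neumann z n k) eventually) : C).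
  assert (Hw : forall k, kpos k -> Cvg (fun n => neumann z n k) (w k)).
  { intros k Hk; apply Cauchy_Cvg; intros eps He.
    destruct (small eps He) as [N HN]; exists N; intros n Hn.
    replace n with ((n - N) + N)%nat by lia.
    apply (Cmod_le_normle (fun k => neumann z (n - N + N) k - neumann z N k)%C); [easy|].
    eapply normle_weaken; [now apply neumann_tail|now apply HN]. }
  assert (Ht : forall N, normle (fun k => w k - neumann z N k)%C (K * r ^ N / (1 - r))).
  { intros N; apply normle_limit with (fun d k => neumann z (d + N) k - neumann z N k)%C.
    - intros k Hk; apply Cvg_minus; [|apply Cvg_const].
      apply (is_lim_seq_incr_n (fun n => Cmod (neumann z n k - w k)) N); now apply Hw.
    - intros d; now apply neumann_tail. }
  assert (Sw : summable w).
  { exists (K * r ^ 0 / (1 - r)); eapply normle_ext; [|apply (Ht 0%nat)].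
    intros k _; change (w k = w k - 0)%C; ring. }
  exists w; split; [easy|]; intros s Hs.
  assert (Lw : Cvg (fun n => ev (neumann z n) s) (ev w s)).
  { apply Cvg_spec; intros eps He; destruct (small eps He) as [N HN].
    exists N; intros n Hn; rewrite Cmod_minus_sym.
    assert (Sn := summable_neumann z n Hz); rewrite <- ev_minus by easy.
    eapply Rle_trans; [|now apply (HN n)]; now apply ev_bound. }
  apply (Cvg_unique (fun n => (1 - ev z s) * ev (neumann z n) s)%C).
  - apply Cvg_mult; [apply Cvg_const|easy].
  - apply Cvg_spec; intros eps He.
    destruct (geom_small K r eps Hr He HK0) as [N HN]; exists N; intros n Hn.
    rewrite Cmult_comm, ev_neumann by easy.
    replace (1 - ev z s ^ n - 1)%C with (- ev z s ^ n)%C by ring.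
    rewrite Cmod_opp, <- ev_kpow by easy.
    eapply Rle_trans; [|now apply (HN n)]; now apply ev_bound.
Qed.

(** The transform of [b] is at most [/ kappa] in modulus, so that of [z], the convolution of [x - y]
    with [b], is at most [d / kappa < 1]. The admissible distance depends on [kappa] alone and not
    on the norm of the inverse, which is what allows steps of a fixed size later. *)
Lemma invertible_perturb x y kappa d : summable x -> summable y -> invertible x -> 0 < kappa ->
  (forall s, H2 s -> kappa <= Cmod (ev x s)) ->
  normle (fun k => x k - y k)%C d -> d < kappa -> invertible y.
Proof.
  intros Hx Hy [b [Hb Eb]] Hk Hlow Hd Hdk.
  assert (Sd := summable_minus x y Hx Hy).
  set (z := kconv (fun k => x k - y k)%C b).
  assert (Sz : summable z) by now apply summable_kconv.
  assert (Ez : forall s, H2 s -> ev z s = ((ev x s - ev y s) * ev b s)%C).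
  { intros s Hs; unfold z; now rewrite ev_kconv, ev_minus. }
  destruct (invertible_one_minus z (d / kappa)) as [w [Sw Ew]].
  - easy.
  - intros s Hs; rewrite Ez, Cmod_mult by easy.
    assert (B1 : Cmod (ev x s - ev y s) <= d).
    { rewrite <- ev_minus by easy; now apply ev_bound. }
    assert (B2 : Cmod (ev x s) * Cmod (ev b s) = 1).
    { rewrite <- Cmod_mult, Eb by easy; apply Cmod_1. }
    pose proof (Hlow s Hs) as B3.
    pose proof (Cmod_ge_0 (ev b s)); pose proof (Cmod_ge_0 (ev x s - ev y s)).
    apply (Rmult_le_reg_r kappa); [easy|].
    replace (d / kappa * kappa) with d by (field; lra).
    assert (kappa * Cmod (ev b s) <= 1) by nra.
    rewrite Rmult_assoc; apply Rle_trans with (Cmod (ev x s - ev y s) * 1); [|lra].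
    apply Rmult_le_compat_l; lra.
  - apply (Rmult_lt_reg_r kappa); [easy|]; field_simplify; lra.
  (* On transforms [1 - z] equals [y * b], so [b * w] inverts [y]. *)
  - exists (kconv b w); split; [now apply summable_kconv|].
    intros s Hs; rewrite ev_kconv by easy.
    rewrite <- (Ew s Hs), Ez by easy.
    replace (1 - (ev x s - ev y s) * ev b s)%C with
      (1 - ev x s * ev b s + ev y s * ev b s)%C by ring.
    rewrite Eb by easy; ring.
Qed.

(** * Deforming to a constant *)

Definition diag (t : R) : C * C := (RtoC t, RtoC t).

Definition dilate (t : R) (x : nat * nat -> C) (k : nat * nat) : C := (chi (diag t) k * x k)%C.

Lemma H2_diag t : 0 <= t -> H2 (diag t).
Proof. intros H; split; exact H. Qed.

Lemma chi_diag t k : chi (diag t) k = RtoC (exp (- (t * (ln (INR (fst k)) + ln (INR (snd k)))))).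
Proof.
  unfold chi, diag, npow_neg, Re, Im, RtoC, Cmult; simpl.
  rewrite !Rmult_0_l, cos_0, sin_0.
  replace (- (t * (ln (INR (fst k)) + ln (INR (snd k))))) with
    (- t * ln (INR (fst k)) + - t * ln (INR (snd k))) by ring.
  rewrite exp_plus; f_equal; ring.
Qed.

Lemma normle_dilate t x A : 0 <= t -> normle x A -> normle (dilate t x) A.
Proof.
  intros Ht; apply normle_le; intros k Hk; unfold dilate; rewrite Cmod_mult.
  pose proof (Cmod_chi_le _ k (H2_diag t Ht) Hk); pose proof (Cmod_ge_0 (x k)); nra.
Qed.

Lemma summable_dilate t x : 0 <= t -> summable x -> summable (dilate t x).
Proof. intros Ht [A HA]; exists A; now apply normle_dilate. Qed.

Lemma ev_dilate t x s : 0 <= t -> summable x -> H2 s ->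
  ev (dilate t x) s = ev x (splus s (diag t)).
Proof.
  intros Ht Hx Hs; apply (Cvg_unique (psum (dilate t x) s)).
  - apply ev_correct; [now apply summable_dilate|easy].
  - apply Cvg_ext with (psum x (splus s (diag t))).
    + intros N; apply lsum_ext; intros k _; unfold dilate; rewrite chi_splus; Cring.
    + apply ev_correct; [easy|]; apply H2_splus; [easy|now apply H2_diag].
Qed.

(** Increasing [t] by [e] multiplies a coefficient by [exp (- (e * L))] with [L = ln m + ln n],
    which differs from 1 by at most [e * L]. On a truncation [L] is bounded; [S N] in place of [N]
    keeps the logarithm meaningful for [N = 0]. *)
Lemma dilate_step N x A t e : 0 <= t -> 0 <= e -> normle (trunc N x) A ->
  normle (fun k => dilate (t + e) (trunc N x) k - dilate t (trunc N x) k)%C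
    (e * (2 * ln (INR (S N))) * A).
Proof.
  intros Ht He Hx.
  assert (HL : 0 <= ln (INR (S N))) by (apply ln_INR_nonneg; lia).
  apply normle_scal with (trunc N x); [nra| |easy].
  intros k Hk; unfold dilate.
  replace (chi (diag (t + e)) k * trunc N x k - chi (diag t) k * trunc N x k)%C
    with (chi (diag t) k * (chi (diag e) k - 1) * trunc N x k)%C.
  2:{ replace (diag (t + e)) with (splus (diag t) (diag e)).
      - rewrite chi_splus; ring.
      - unfold splus, diag; simpl; now rewrite RtoC_plus. }
  unfold trunc; destruct (in_dec key_eq_dec k (Box N)) as [Hi|Hi].
  2:{ rewrite Cmult_0_r, Cmod_0; lra. }
  rewrite !Cmod_mult; apply Rmult_le_compat_r; [apply Cmod_ge_0|].
  pose proof (Cmod_chi_le _ k (H2_diag t Ht) Hk).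
  apply Rle_trans with (Cmod (chi (diag e) k - 1)).
  { pose proof (Cmod_ge_0 (chi (diag e) k - 1)); nra. }
  rewrite chi_diag, <- RtoC_minus, Cmod_R.
  set (L := ln (INR (fst k)) + ln (INR (snd k))).
  assert (HL0 : 0 <= L) by (destruct Hk; apply Rplus_le_le_0_compat; now apply ln_INR_nonneg).
  assert (HLN : L <= 2 * ln (INR (S N))).
  { apply in_Box in Hi; destruct Hi as [[H1 H2] H3]; unfold kmax in H3.
    assert (forall n, (1 <= n <= N)%nat -> ln (INR n) <= ln (INR (S N))).
    { intros n Hn; apply ln_le; [apply lt_0_INR; lia|apply le_INR; lia]. }
    unfold L; assert (ln (INR (fst k)) <= ln (INR (S N))) by (apply H0; lia).
    assert (ln (INR (snd k)) <= ln (INR (S N))) by (apply H0; lia); lra. }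
  pose proof (exp_ineq1_le (- (e * L))).
  assert (exp (- (e * L)) <= 1) by (apply exp_neg_le_1; nra).
  rewrite Rabs_left1 by lra; nra.
Qed.

(** Away from [(1, 1)] the product [m * n] is at least 2, so the dilation factor is at most
    [exp (- (t * ln 2))], hence at most [/ (1 + t * ln 2)]. *)
Lemma dilate_far x A t : 0 <= t -> normle x A ->
  normle (fun k => x (1, 1)%nat * kdelta k - dilate t x k)%C (/ (1 + t * ln 2) * A).
Proof.
  intros Ht Hx.
  assert (HL : 0 < ln 2) by (pose proof ln_lt_2; lra).
  assert (Hp : 0 < 1 + t * ln 2) by nra.
  apply normle_scal with x; [apply Rlt_le, Rinv_0_lt_compat, Hp| |easy].
  intros k Hk; unfold dilate, kdelta; destruct (key_eq_dec k (1, 1)%nat) as [->|Hne].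
  - rewrite chi_one; replace (x (1, 1)%nat * 1 - 1 * x (1, 1)%nat)%C with (RtoC 0) by ring.
    rewrite Cmod_0; apply Rmult_le_pos; [apply Rlt_le, Rinv_0_lt_compat, Hp|apply Cmod_ge_0].
  - replace (x (1, 1)%nat * 0 - chi (diag t) k * x k)%C with (- (chi (diag t) k * x k))%C by ring.
    rewrite Cmod_opp, Cmod_mult; apply Rmult_le_compat_r; [apply Cmod_ge_0|].
    rewrite chi_diag, Cmod_R, Rabs_pos_eq by apply Rlt_le, exp_pos.
    set (L := ln (INR (fst k)) + ln (INR (snd k))).
    assert (H2L : ln 2 <= L).
    { assert (P : forall n, (2 <= n)%nat -> ln 2 <= ln (INR n)).
      { intros n Hn; apply ln_le; [lra|]; change 2 with (INR 2); now apply le_INR. }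
      destruct k as [m n], Hk as [Hm Hn]; unfold L; simpl in *.
      pose proof (ln_INR_nonneg m Hm); pose proof (ln_INR_nonneg n Hn).
      destruct (Nat.eq_dec m 1) as [->|Hm1].
      - destruct (Nat.eq_dec n 1) as [->|Hn1]; [easy|].
        pose proof (P n ltac:(lia)); lra.
      - pose proof (P m ltac:(lia)); lra. }
    rewrite exp_Ropp; apply Rinv_le_contravar; [easy|].
    pose proof (exp_ineq1_le (t * L)); nra.
Qed.

Lemma invertible_trunc N x kappa : summable x -> 0 < kappa ->
  (forall s, H2 s -> kappa <= Cmod (ev (trunc N x) s)) -> invertible (trunc N x).
Proof.
  intros Hx Hk Hlow; set (y := trunc N x) in *.
  assert (Hy : summable y) by now apply summable_trunc.
  destruct (Hy) as [A HA].
  pose proof (normle_nonneg _ _ HA) as HA0.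
  assert (HL : 0 <= ln (INR (S N))) by (apply ln_INR_nonneg; lia).
  assert (HL2 : 0 < ln 2) by (pose proof ln_lt_2; lra).
  assert (Hlow' : forall t, 0 <= t -> forall s, H2 s -> kappa <= Cmod (ev (dilate t y) s)).
  { intros t Ht s Hs; rewrite ev_dilate by easy; apply Hlow, H2_splus; [easy|now apply H2_diag]. }
  (* With this step length a dilate moves by at most [kappa / 2] in norm, whatever the value of
     [t]. *)
  set (e := kappa / (2 * (2 * ln (INR (S N)) * A + 1))).
  assert (HB : 0 < 2 * ln (INR (S N)) * A + 1) by nra.
  assert (He : 0 < e) by (apply Rdiv_lt_0_compat; lra).
  assert (step : forall t, 0 <= t -> invertible (dilate (t + e) y) -> invertible (dilate t y)).
  { intros t Ht Hi.
    apply (invertible_perturb (dilate (t + e) y) (dilate t y) kappa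
      (e * (2 * ln (INR (S N))) * A)); try apply summable_dilate; try easy; try lra.
    - apply Hlow'; lra.
    - now apply dilate_step; [|apply Rlt_le|].
    - assert (e * (2 * ln (INR (S N)) * A + 1) = kappa / 2) by (unfold e; field; lra).
      nra. }
  assert (far : exists J, invertible (dilate (INR J * e) y)).
  { destruct (INR_unbounded (4 * A / kappa / ln 2 / e)) as [J HJ]; exists J.
    assert (HJ1 : 4 * A / kappa < INR J * e * ln 2).
    { replace (4 * A / kappa) with (4 * A / kappa / ln 2 / e * (e * ln 2)) by (field; lra).
      rewrite Rmult_assoc; apply Rmult_lt_compat_r; [nra|exact HJ]. }
    set (t := INR J * e) in *.
    assert (Ht : 0 <= t) by (apply Rmult_le_pos; [apply pos_INR|lra]).
    assert (Hsm : / (1 + t * ln 2) * A <= kappa / 4).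
    { assert (0 < 1 + t * ln 2) by nra.
      apply (Rmult_le_reg_l (1 + t * ln 2)); [easy|].
      rewrite <- Rmult_assoc, Rinv_r, Rmult_1_l by lra.
      assert (4 * A < kappa * (t * ln 2)).
      { replace (4 * A) with (kappa * (4 * A / kappa)) by (field; lra).
        now apply Rmult_lt_compat_l. }
      nra. }
    set (c := y (1, 1)%nat).
    assert (Sd : summable kdelta) by (exists 1; exact normle_kdelta).
    assert (Sc : summable (fun k => c * kdelta k)%C) by now apply summable_scal.
    assert (Ec : forall s, H2 s -> ev (fun k => c * kdelta k)%C s = c).
    { intros s Hs; rewrite ev_scal, ev_kdelta by easy; ring. }
    assert (St := summable_dilate t y Ht Hy).
    assert (Hfar := dilate_far y A t Ht HA); fold c in Hfar.
    (* At the origin the transform of the dilate has modulus at least [kappa] and lies within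
       [kappa / 4] of [c]. *)
    assert (Hc : 3 * kappa / 4 <= Cmod c).
    { assert (H0 : H2 (diag 0)) by (apply H2_diag; lra).
      pose proof (Hlow' t Ht _ H0) as B1.
      pose proof (ev_bound _ _ _ H0 Hfar) as B2.
      rewrite ev_minus, Ec in B2 by easy.
      replace (ev (dilate t y) (diag 0)) with (c + - (c - ev (dilate t y) (diag 0)))%C in B1 by ring.
      pose proof (Cmod_triangle c (- (c - ev (dilate t y) (diag 0)))) as B3.
      rewrite (Cmod_opp (c - _)) in B3; lra. }
    assert (Hc0 : c <> 0) by (apply Cmod_gt_0; lra).
    apply (invertible_perturb (fun k => c * kdelta k)%C _ (3 * kappa / 4) (/ (1 + t * ln 2) * A));
      try easy; try lra.
    - exists (fun k => / c * kdelta k)%C; split; [now apply summable_scal|].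
      intros s Hs; rewrite Ec, ev_scal, ev_kdelta by easy; field; easy.
    - intros s Hs; now rewrite Ec. }
  assert (H0 : invertible (dilate 0 y)).
  { destruct far as [J HJ]; induction J as [|J IH].
    - simpl in HJ; rewrite Rmult_0_l in HJ; exact HJ.
    - apply IH, step; [apply Rmult_le_pos; [apply pos_INR|lra]|].
      replace (INR J * e + e) with (INR (S J) * e) by (rewrite S_INR; ring); easy. }
  destruct H0 as [b [Hb Eb]]; exists b; split; [easy|]; intros s Hs.
  rewrite <- (Eb s Hs), ev_dilate by (easy || lra).
  replace (splus s (diag 0)) with s; [easy|].
  destruct s; unfold splus, diag; simpl; now rewrite !Cplus_0_r.
Qed.

(** A truncation within [kappa / 4] of [x] keeps the lower bound [3 * kappa / 4], hence is
    invertible, and [x] is close enough to it to inherit this. *)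
Lemma invertible_bounded_below x kappa : summable x -> 0 < kappa ->
  (forall s, H2 s -> kappa <= Cmod (ev x s)) -> invertible x.
Proof.
  intros Hx Hk Hlow.
  destruct (trunc_tail x (kappa / 4) Hx ltac:(lra)) as [N HN]; specialize (HN N (le_n N)).
  assert (Sy := summable_trunc N x Hx).
  assert (Hy : forall s, H2 s -> 3 * kappa / 4 <= Cmod (ev (trunc N x) s)).
  { intros s Hs; pose proof (ev_bound _ _ _ Hs HN) as B; rewrite ev_minus in B by easy.
    pose proof (Cmod_triangle (ev (trunc N x) s) (ev x s - ev (trunc N x) s)) as B1.
    replace (ev (trunc N x) s + (ev x s - ev (trunc N x) s))%C with (ev x s) in B1 by ring.
    pose proof (Hlow s Hs); lra. }
  apply (invertible_perturb (trunc N x) x (3 * kappa / 4) (kappa / 4)); try easy; try lra.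
  - apply invertible_trunc with (3 * kappa / 4); [easy|lra|easy].
  - eapply normle_le; [|exact HN]; intros k _; rewrite Cmod_minus_sym; apply Rle_refl.
Qed.

(** * Translation to the original statement *)

Lemma represents_ev a F : l1 a -> represents a F ->
  forall s1 s2, inH s1 -> inH s2 -> F s1 s2 = ev (uncurry2 a) (s1, s2).
Proof.
  intros Ha HF s1 s2 H1 H2.
  apply (Cvg_unique (psum (uncurry2 a) (s1, s2))).
  - apply Cvg_filterlim; eapply filterlim_ext; [|apply (HF s1 s2 H1 H2)].
    intros N; rewrite box_sum_lsum; apply lsum_ext; intros k _.
    unfold uncurry2, chi; simpl; Cring.
  - apply ev_correct; [now apply l1_summable|now split].
Qed.

Lemma ev_represents a : l1 a -> represents a (fun s1 s2 => ev (uncurry2 a) (s1, s2)).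
Proof.
  intros Ha s1 s2 H1 H2; unfold dirichlet_sum_is.
  eapply filterlim_ext; [|apply Cvg_filterlim, (ev_correct (uncurry2 a) (s1, s2))].
  - intros N; rewrite box_sum_lsum; apply lsum_ext; intros k _.
    unfold uncurry2, chi; simpl; Cring.
  - now apply l1_summable.
  - now split.
Qed.

Lemma uncurry2_curry (b : nat * nat -> C) : uncurry2 (fun m n => b (m, n)) = b.
Proof. apply functional_extensionality; now intros [m n]. Qed.

(** Evaluating the convolution identity gives one direction. In the other, [ev_inj] recovers both
    one-sided identities from the single commutative identity between transforms. *)
Lemma l1_invertible_iff a : l1 a -> (l1_invertible a <-> invertible (uncurry2 a)).
Proof.
  intros Ha; assert (Sa := proj1 (l1_summable a) Ha).
  assert (Sd : summable kdelta) by (exists 1; exact normle_kdelta).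
  assert (Ed : forall m n, delta11 m n = kdelta (m, n)).
  { intros m n; unfold delta11, kdelta.
    destruct (Nat.eqb_spec m 1), (Nat.eqb_spec n 1), (key_eq_dec (m, n) (1, 1)%nat);
      simpl; congruence. }
  split.
  - intros [b [Hb E]]; assert (Sb := proj1 (l1_summable b) Hb).
    exists (uncurry2 b); split; [easy|]; intros s Hs.
    assert (Sab := summable_kconv _ _ Sa Sb).
    rewrite <- ev_kconv, <- (ev_kdelta s) by easy.
    apply (Cvg_unique (psum (kconv (uncurry2 a) (uncurry2 b)) s)); [now apply ev_correct|].
    apply Cvg_ext with (psum kdelta s); [|now apply ev_correct].
    intros N; apply lsum_ext; intros [m n] Hk; apply in_Box in Hk; destruct Hk as [[Hm Hn] _].
    rewrite <- conv_kconv, <- Ed by easy; now rewrite (proj1 (E m n Hm Hn)).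
  - intros [b [Sb E]].
    exists (fun m n => b (m, n)); split; [apply l1_summable; now rewrite uncurry2_curry|].
    intros m n Hm Hn; rewrite !conv_kconv, Ed, uncurry2_curry by easy.
    split; (apply ev_inj; [now apply summable_kconv|easy| |now split]);
      intros s Hs; rewrite ev_kconv, ev_kdelta by easy; [|rewrite Cmult_comm]; now apply E.
Qed.

Theorem theoremA (F : C -> C -> C) (a : nat -> nat -> C) :
  l1 a -> represents a F ->
  ( (exists G : C -> C -> C, has_ACDS G /\
       forall s1 s2 : C, inH s1 -> inH s2 -> (F s1 s2 * G s1 s2)%C = (1:C))
    <-> l1_invertible a ) /\
  ( l1_invertible a <-> bounded_away_from_zero F ).
Proof.
  intros Ha HF.
  assert (Sa := proj1 (l1_summable a) Ha).
  assert (EF := represents_ev a F Ha HF).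
  rewrite l1_invertible_iff by easy.
  split; split.
  (* From (i) to (ii): the coefficients of the reciprocal series form the inverse. *)
  - intros [G [[b [Hb HG]] E]].
    exists (uncurry2 b); split; [now apply l1_summable|].
    intros [s1 s2] [H1 H2]; simpl in *.
    rewrite <- EF, <- (represents_ev b G Hb HG) by easy; now apply E.
  - intros [b [Sb E]].
    assert (Hb : l1 (fun m n => b (m, n))) by (apply l1_summable; now rewrite uncurry2_curry).
    exists (fun s1 s2 => ev b (s1, s2)); split.
    + exists (fun m n => b (m, n)); split; [easy|].
      pose proof (ev_represents _ Hb) as Hr; rewrite uncurry2_curry in Hr; exact Hr.
    + intros s1 s2 H1 H2; rewrite EF by easy; apply E; now split.
  - intros [b [[B HB] E]]; pose proof (normle_nonneg _ _ HB).
    (* If [B] bounds the norm of the inverse, [/ B] would be the natural lower bound; adding 1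
       covers [B = 0]. *)
    exists (/ (B + 1)); split; [apply Rinv_0_lt_compat; lra|].
    intros s1 s2 H1 H2; rewrite EF by easy.
    assert (Hs : inH s1 /\ inH s2) by easy.
    pose proof (ev_bound b (s1, s2) B Hs HB) as Hb.
    assert (P : Cmod (ev (uncurry2 a) (s1, s2)) * Cmod (ev b (s1, s2)) = 1).
    { rewrite <- Cmod_mult, (E (s1, s2) Hs); apply Cmod_1. }
    apply (Rmult_le_reg_r (B + 1)); [lra|]; rewrite Rinv_l by lra.
    pose proof (Cmod_ge_0 (ev (uncurry2 a) (s1, s2))); nra.
  - intros [k [Hk Hlow]].
    apply (invertible_bounded_below _ k); [easy|easy|].
    intros [s1 s2] [H1 H2]; rewrite <- EF by easy; now apply Hlow.
Qed.
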